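(* Let $n\ge3$ and $I=\{1,\dots,n-1\}$ label the path diagram $A_{n-1}$. Then $\mathrm{Spin}(n)$, together with the homomorphisms $\tau_{i,i+1}:=\widetilde\varepsilon_{\{i,i+1,i+2\}}:\mathrm{Spin}(3)\to\mathrm{Spin}(n)$ and, for $i<j$ with $j\ne i+1$, $\tau_{ij}:\mathrm{Spin}(2)\times\mathrm{Spin}(2)\to\mathrm{Spin}(n)$, $(x,y)\mapsto \widetilde\varepsilon_{\{i,i+1\}}(x)\,\widetilde\varepsilon_{\{j,j+1\}}(y)$, is a universal enveloping group of the standard $\mathrm{Spin}(2)$-amalgam $\mathcal A(A_{n-1},\mathrm{Spin}(2))$.
   Context: $\mathrm{Spin}(m)$ is realised in the real Clifford algebra generated by $e_1,\dots,e_m$ with $e_k^2=-1$, $e_ke_l=-e_le_k$ ($k\ne l$); $\mathrm{Spin}(2)=\{S(\alpha)=\cos\alpha+\sin\alpha\,e_1e_2\}$. For $L=\{l_1<\dots<l_m\}\subseteq\{1,\dots,n\}$, $\widetilde\varepsilon_L:\mathrm{Spin}(m)\to\mathrm{Spin}(n)$ is the embedding induced by $e_k\mapsto e_{l_k}$. The standard $\mathrm{Spin}(2)$-amalgam $\mathcal A(A_{n-1},\mathrm{Spin}(2))$ has $G_{i,i+1}=\mathrm{Spin}(3)$ with $\phi^i_{i,i+1}=\widetilde\varepsilon_{\{1,2\}}$ ($a+be_1e_2\mapsto a+be_1e_2$), $\phi^{i+1}_{i,i+1}=\widetilde\varepsilon_{\{2,3\}}$ ($a+be_1e_2\mapsto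 a+be_2e_3$), and for $i<j$, $j\ne i+1$, $G_{ij}=\mathrm{Spin}(2)\times\mathrm{Spin}(2)$ with $\phi^i_{ij}(x)=(x,1)$, $\phi^j_{ij}(x)=(1,x)$. Enveloping and universal enveloping groups of an amalgam $\{G_{ij},\phi^i_{ij}\}$: a group $G$ with homomorphisms $\tau_{ij}:G_{ij}\to G$ whose images generate $G$, satisfying $\tau_{ij}\circ\phi^j_{ij}=\tau_{kj}\circ\phi^j_{kj}$ for pairwise distinct $i,j,k$; universal if it maps uniquely and compatibly onto every other enveloping group. *)

(* Defs.v *)
From Stdlib Require Import Reals.
From mathcomp Require Import all_boot.
Unset Printing Implicit Defensive.

(* The real Clifford algebra Cl(m) generated by e_1,...,e_m with       *)
(* e_k^2 = -1, e_k e_l = - e_l e_k.  Basis blades e_A are indexed by   *)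
(* subsets A of 'I_m (0-based: k : 'I_m stands for e_(k+1)); an        *)
(* element is its coefficient function.                                *)
Definition Cl (m : nat) : Type := {set 'I_m} -> R.

(* sign in e_A e_B = clsgn A B * e_(A symdiff B) *)
Definition inv_pairs (m : nat) (A B : {set 'I_m}) : {set 'I_m * 'I_m} :=
  [set p : 'I_m * 'I_m | (p.1 \in A) && (p.2 \in B) && (val p.2 < val p.1)%N].

Definition clsgn (m : nat) (A B : {set 'I_m}) : R :=
  if odd (#|inv_pairs m A B| + #|A :&: B|) then Ropp R1 else R1.

Definition symdiff (m : nat) (A B : {set 'I_m}) : {set 'I_m} := (A :\: B) :|: (B :\: A).

Definition clmul (m : nat) (x y : Cl m) : Cl m := fun C =>
  \big[Rplus/R0]_(A : {set 'I_m})
     Rmult (clsgn m A (symdiff m A C)) (Rmult (x A) (y (symdiff m A C))).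

Definition clone (m : nat) : Cl m := fun C => if C == set0 then R1 else R0.

Definition unit_vector (m : nat) (v : Cl m) : Prop :=
  (forall C : {set 'I_m}, #|C| <> 1%N -> v C = R0) /\
  \big[Rplus/R0]_(k : 'I_m) Rsqr (v [set k]) = R1.

Definition cl_prod (m : nat) (l : seq (Cl m)) : Cl m := foldr (clmul m) (clone m) l.

Definition in_spin (m : nat) (x : Cl m) : Prop :=
  exists l : seq (Cl m), ~~ odd (size l) /\ List.Forall (unit_vector m) l /\ x = cl_prod m l.

(* eps_L : Cl(m) -> Cl(n) induced by e_k |-> e_(l_k), L = [:: l_1; ...; l_m]
   given 1-based as in the paper (so e_(k+1) |-> e_(nth L k)). *)
Definition eps (m n : nat) (L : seq nat) (x : Cl m) : Cl n := fun B =>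
  \big[Rplus/R0]_(A : {set 'I_m} |
        [forall b : 'I_n, (b \in B) == [exists a in A, (nth 0%N L (val a)).-1 == val b]])
     x A.

(* Groups given as a carrier with a membership predicate (a subset of  *)
(* a multiplicative structure), so that Spin(m) can be realised inside *)
(* Cl(m).                                                              *)
Record grp := Grp { car : Type; gmem : car -> Prop; gmul : car -> car -> car; gone : car }.

Definition is_group (G : grp) : Prop :=
  gmem G (gone G) /\
  (forall x y, gmem G x -> gmem G y -> gmem G (gmul G x y)) /\
  (forall x y z, gmem G x -> gmem G y -> gmem G z ->
     gmul G x (gmul G y z) = gmul G (gmul G x y) z) /\
  (forall x, gmem G x -> gmul G (gone G) x = x /\ gmul G x (gone G) = x) /\
  (forall x, gmem G x -> exists y, gmem G y /\ gmul G x y = gone G /\ gmul G y x = gone G).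

Definition hom (G H : grp) (f : car G -> car H) : Prop :=
  (forall x, gmem G x -> gmem H (f x)) /\
  (forall x y, gmem G x -> gmem G y -> f (gmul G x y) = gmul H (f x) (f y)).

Inductive gen (G : grp) (S : car G -> Prop) : car G -> Prop :=
| gen_base x : S x -> gen G S x
| gen_one : gen G S (gone G)
| gen_mul x y : gen G S x -> gen G S y -> gen G S (gmul G x y)
| gen_inv x y : gen G S x -> gmem G y -> gmul G x y = gone G -> gen G S y.

Definition SpinG (m : nat) : grp := Grp (Cl m) (in_spin m) (clmul m) (clone m).

Definition prodgrp (G1 G2 : grp) : grp :=
  Grp (car G1 * car G2) (fun p : car G1 * car G2 => gmem G1 p.1 /\ gmem G2 p.2)
      (fun p q => (gmul G1 p.1 q.1, gmul G2 p.2 q.2)) (gone G1, gone G2).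

(* Amalgams over an index set I = {1,...,N}: vertex groups G_i, edge   *)
(* groups G_ij (i < j) and embeddings phi^i_ij (aphiL), phi^j_ij       *)
(* (aphiR).                                                            *)
Record amalgam := Amalgam {
  agrp_v : nat -> grp;
  agrp_e : nat -> nat -> grp;
  aphiL : forall i j, car (agrp_v i) -> car (agrp_e i j);
  aphiR : forall i j, car (agrp_v j) -> car (agrp_e i j) }.

Definition inI (N i : nat) : bool := (1 <= i <= N)%N.

(* tau_{ij} o phi^j_{ij} for the unordered pair {i,j} *)
Definition vert_emb (A : amalgam) (H : grp) (tau : forall i j, car (agrp_e A i j) -> car H)
  (i j : nat) : car (agrp_v A j) -> car H :=
  if (i < j)%N then fun x => tau i j (aphiR A i j x)
  else fun x => tau j i (aphiL A j i x).

Definition enveloping (N : nat) (A : amalgam) (H : grp)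
  (tau : forall i j, car (agrp_e A i j) -> car H) : Prop :=
  is_group H /\
  (forall i j, inI N i -> inI N j -> (i < j)%N -> hom (agrp_e A i j) H (tau i j)) /\
  (forall h, gmem H h ->
     gen H (fun h' => exists i j x, [/\ inI N i, inI N j, (i < j)%N,
                                     gmem (agrp_e A i j) x & h' = tau i j x]) h) /\
  (forall i j k, inI N i -> inI N j -> inI N k -> i <> j -> j <> k -> i <> k ->
     forall x, gmem (agrp_v A j) x -> vert_emb A H tau i j x = vert_emb A H tau k j x).

Definition compatible (N : nat) (A : amalgam) (H H' : grp)
  (tau : forall i j, car (agrp_e A i j) -> car H)
  (tau' : forall i j, car (agrp_e A i j) -> car H') (pi : car H -> car H') : Prop :=
  forall i j x, inI N i -> inI N j -> (i < j)%N -> gmem (agrp_e A i j) x ->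
    pi (tau i j x) = tau' i j x.

Definition universal_enveloping (N : nat) (A : amalgam) (H : grp)
  (tau : forall i j, car (agrp_e A i j) -> car H) : Prop :=
  enveloping N A H tau /\
  forall (H' : grp) (tau' : forall i j, car (agrp_e A i j) -> car H'),
    enveloping N A H' tau' ->
    exists pi : car H -> car H',
      [/\ hom H H' pi,
          (forall h', gmem H' h' -> exists h, gmem H h /\ pi h = h'),
          compatible N A H H' tau tau' pi &
          (forall pi', hom H H' pi' -> compatible N A H H' tau tau' pi' ->
             forall h, gmem H h -> pi' h = pi h)].

Definition spin_edge (i j : nat) : grp :=
  if j == i.+1 then SpinG 3 else prodgrp (SpinG 2) (SpinG 2).

Definition spin_phiL (i j : nat) : car (SpinG 2) -> car (spin_edge i j) :=
  match j == i.+1 as b return car (SpinG 2) -> car (if b then SpinG 3 else prodgrp (SpinG 2) (SpinG 2)) with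
  | true => eps 2 3 [:: 1; 2]%N
  | false => fun x => (x, clone 2)
  end.

Definition spin_phiR (i j : nat) : car (SpinG 2) -> car (spin_edge i j) :=
  match j == i.+1 as b return car (SpinG 2) -> car (if b then SpinG 3 else prodgrp (SpinG 2) (SpinG 2)) with
  | true => eps 2 3 [:: 2; 3]%N
  | false => fun x => (clone 2, x)
  end.

Definition spin2_amalgam : amalgam :=
  Amalgam (fun _ => SpinG 2) spin_edge spin_phiL spin_phiR.

Definition spin_tau (n i j : nat) : car (agrp_e spin2_amalgam i j) -> car (SpinG n) :=
  match j == i.+1 as b return car (if b then SpinG 3 else prodgrp (SpinG 2) (SpinG 2)) -> Cl n with
  | true => eps 3 n [:: i; i.+1; i.+2]
  | false => fun p => clmul n (eps 2 n [:: i; i.+1] p.1) (eps 2 n [:: j; j.+1] p.2)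
  end.

(* Main.v *)
Require Import Defs.
From Stdlib Require Import Reals.
From mathcomp Require Import all_boot.
From HB Require Import structures.
From mathcomp Require Import all_order all_algebra ring zify boolp Rstruct.

(** Let [K] be the group Spin(k) on e_1..e_k, [A] the group Spin(2) on e_k, e_(k+1), [M] the
    group Spin(k-1) on e_1..e_(k-1), and [B], [T] the groups Spin(2), Spin(3) on the last 2
    vectors of [K] and the last 3 vectors e_(k-1), e_k, e_(k+1). Then Spin(k+1) = K A K,
    K = M B M and T = B A B, and [M] commutes with [A]. Given compatible homomorphisms [f] on [K]
    and [t] on [T], the relation {(x a y, f x * t a * f y)} is stable under multiplication: in
    (x a y) a' with y = m b m', the factors m, m' pass through [A], and a b a' lies in T = B A B.
    So the relation is a subgroup of Spin(k+1) x G, and since [K] and [A] meet inside [B], where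
    [f] and [t] agree, its fibre over 1 is trivial. Hence it is the graph of a homomorphism on
    Spin(k+1), and induction on k gives the universal property. *)

Import GRing.Theory Num.Theory Order.TTheory.
Set Implicit Arguments.
Unset Strict Implicit.
Unset Printing Implicit Defensive.
Local Open Scope ring_scope.

(** * Clifford multiplication as a ring structure *)

Section Blades.
Variable n : nat.
Implicit Types A B C D : {set 'I_n}.

Lemma in_symdiff A B x : (x \in symdiff n A B) = (x \in A) (+) (x \in B).
Proof. by rewrite !inE; case: (x \in A); case: (x \in B). Qed.

Lemma symdiffC A B : symdiff n A B = symdiff n B A.
Proof. by apply/setP=> x; rewrite !in_symdiff addbC. Qed.

Lemma symdiffK A : involutive (symdiff n A).
Proof. by move=> B; apply/setP=> x; rewrite !in_symdiff addKb. Qed.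

Lemma symdiff0 A : symdiff n A set0 = A.
Proof. by apply/setP=> x; rewrite in_symdiff inE addbF. Qed.

Lemma sym0diff A : symdiff n set0 A = A.
Proof. by rewrite symdiffC symdiff0. Qed.

Lemma symdiff_eq0 A B : (symdiff n A B == set0) = (A == B).
Proof.
apply/eqP/eqP=> [AB|->]; first by rewrite -(symdiffK A B) AB symdiff0.
by apply/setP=> x; rewrite in_symdiff addbb inE.
Qed.

(** Elements of [A :&: B] are absent on the left and occur twice on the right, where they contribute
    [f a * f a = 1]. *)
Lemma prod_symdiff (f : 'I_n -> R) A B : (forall a, f a * f a = 1) ->
  \prod_(a in symdiff n A B) f a = \prod_(a in A) f a * \prod_(a in B) f a.
Proof.
move=> ff; rewrite big_mkcond [X in X * _]big_mkcond [X in _ * X]big_mkcond.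
rewrite -big_split; apply: eq_bigr => a _; rewrite in_symdiff.
by case: (a \in A); case: (a \in B); rewrite /= ?ff ?mulr1 ?mul1r.
Qed.

(* The exponent in [clsgn] counts the pairs (a, b) in A x B with b <= a; in this form the
   sign is visibly a bicharacter of the group of subsets under symmetric difference. *)
Lemma clsgnE A B : clsgn n A B = \prod_(a in A) \prod_(b in B) (-1) ^+ (b <= a)%N.
Proof.
under eq_bigr do rewrite prodrXr.
rewrite prodrXr -signr_odd /clsgn.
suff -> : (\sum_(a in A) \sum_(b in B) (b <= a) = #|inv_pairs n A B| + #|A :&: B|)%N.
  by case: odd; rewrite ?expr1 ?expr0.
have -> : #|inv_pairs n A B| = (\sum_(a in A) \sum_(b in B) (b < a))%N.
  rewrite pair_big_dep /= big_mkcond /= -sum1_card big_mkcond /=.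
  by apply: eq_bigr => -[a b] _; rewrite inE /=; case: (a \in A); case: (b \in B); case: ltnP.
have -> : #|A :&: B| = (\sum_(a in A) \sum_(b in B) (b == a))%N.
  rewrite -sum1_card big_mkcond /= [RHS]big_mkcond; apply: eq_bigr => a _.
  rewrite inE; case: (a \in A) => //=; case: ifP => aB.
    by rewrite (bigD1 a) //= eqxx big1 ?addn0 // => b /andP[_ /negPf->].
  by rewrite big1 // => b bB; case: eqP => // ba; rewrite -ba bB in aB.
rewrite -big_split; apply: eq_bigr => a _; rewrite -big_split; apply: eq_bigr => b _ /=.
by rewrite leq_eqVlt (val_eqE b a); case: eqP => [->|_]; rewrite ?ltnn ?addn0.
Qed.

Lemma clsgnDl A B C : clsgn n (symdiff n A B) C = clsgn n A C * clsgn n B C.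
Proof.
by rewrite !clsgnE prod_symdiff // => a; rewrite -big_split /= big1 // => b _; rewrite -expr2 sqrr_sign.
Qed.

Lemma clsgnDr A B C : clsgn n A (symdiff n B C) = clsgn n A B * clsgn n A C.
Proof.
rewrite !clsgnE -big_split; apply: eq_bigr => a _; rewrite prod_symdiff // => b.
by rewrite -expr2 sqrr_sign.
Qed.

Lemma clsgn0l A : clsgn n set0 A = 1.
Proof. by rewrite clsgnE big_set0. Qed.

Lemma clsgn0r A : clsgn n A set0 = 1.
Proof. by rewrite clsgnE big1 // => a _; rewrite big_set0. Qed.

Lemma clsgn11 i j : clsgn n [set i] [set j] = (-1) ^+ (j <= i)%N.
Proof. by rewrite clsgnE !big_set1. Qed.

End Blades.

Section CliffordRing.
Variable n : nat.
Implicit Types x y z : Cl n.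

HB.instance Definition _ := gen_eqMixin (Cl n).
HB.instance Definition _ := gen_choiceMixin (Cl n).

Let cladd x y : Cl n := fun A => x A + y A.
Let clopp x : Cl n := fun A => - x A.
Let clzero : Cl n := fun=> 0.

Let claddA : associative cladd.
Proof. by move=> x y z; apply: funext => A; exact: addrA. Qed.
Let claddC : commutative cladd.
Proof. by move=> x y; apply: funext => A; exact: addrC. Qed.
Let cladd0 : left_id clzero cladd.
Proof. by move=> x; apply: funext => A; exact: add0r. Qed.
Let claddN : left_inverse clzero clopp cladd.
Proof. by move=> x; apply: funext => A; exact: addNr. Qed.

HB.instance Definition _ := GRing.isZmodule.Build (Cl n) claddA claddC cladd0 claddN.

Lemma clmulE x y C :
  clmul n x y C = \sum_A clsgn n A (symdiff n A C) * (x A * y (symdiff n A C)).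
Proof. by []. Qed.

(** Associativity amounts to the cocycle identity for [clsgn], which holds because [clsgn] is a
    bicharacter. *)
Let clmulA : associative (clmul n).
Proof.
move=> x y z; apply: funext => D; rewrite !clmulE.
under eq_bigr do rewrite clmulE !mulr_sumr.
under [RHS]eq_bigr do rewrite clmulE mulr_suml mulr_sumr.
rewrite [RHS]exchange_big /=; apply: eq_bigr => B _.
(* After this substitution both sides carry [x] at [B], [y] at [symdiff n B A] and [z] at
   [symdiff n A D], so only signs remain to be compared. *)
rewrite (reindex_inj (inv_inj (symdiffK B))) /=; apply: eq_bigr => A _.
have -> : symdiff n (symdiff n B A) (symdiff n B D) = symdiff n A D.
  by apply/setP=> u; rewrite !in_symdiff; do !case: (u \in _).
have -> : clsgn n B (symdiff n B D) = clsgn n B (symdiff n B A) * clsgn n B (symdiff n A D).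
  by rewrite -clsgnDr; congr clsgn; apply/setP=> u; rewrite !in_symdiff; do !case: (u \in _).
rewrite clsgnDl.
have : clsgn n B (symdiff n A D) * clsgn n B (symdiff n A D) = 1.
  by rewrite /clsgn; case: odd; rewrite ?mulr1 // RoppE mulrNN mulr1.
move: (clsgn n B (symdiff n A D)) (clsgn n A (symdiff n A D)) (clsgn n B (symdiff n B A)) => s t r ss.
by ring: ss.
Qed.
Let clmul1l : left_id (clone n) (clmul n).
Proof.
move=> x; apply: funext => C; rewrite clmulE (bigD1 set0) //= big1 => [|A A0].
  by rewrite addr0 sym0diff clsgn0l /clone eqxx !mul1r.
by rewrite /clone (negPf A0) mul0r mulr0.
Qed.
Let clmul1r : right_id (clone n) (clmul n).
Proof.
move=> x; apply: funext => C; rewrite clmulE (bigD1 C) //= big1 => [|A A0].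
  by rewrite addr0 (eqP (_ : symdiff n C C == set0)) ?symdiff_eq0 // clsgn0r /clone eqxx mul1r mulr1.
by rewrite /clone symdiff_eq0 (negPf A0) !mulr0.
Qed.
Let clmulDl : left_distributive (clmul n) +%R.
Proof.
move=> x y z; apply: funext => C; rewrite /GRing.add /= /cladd !clmulE -big_split.
by apply: eq_bigr => A _ /=; rewrite mulrDl mulrDr.
Qed.
Let clmulDr : right_distributive (clmul n) +%R.
Proof.
move=> x y z; apply: funext => C; rewrite /GRing.add /= /cladd !clmulE -big_split.
by apply: eq_bigr => A _ /=; rewrite !mulrDr.
Qed.
Let clone_neq0 : clone n != 0.
Proof.
apply/eqP => /(congr1 (fun x : Cl n => x set0)); rewrite /clone eqxx => /eqP.
by rewrite oner_eq0.
Qed.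

HB.instance Definition _ := GRing.Zmodule_isNzRing.Build (Cl n)
  clmulA clmul1l clmul1r clmulDl clmulDr clone_neq0.

Let clscale (c : R) x : Cl n := fun A => c * x A.
Let clscaleA a b x : clscale a (clscale b x) = clscale (a * b) x.
Proof. by apply: funext => A; exact: mulrA. Qed.
Let clscale1 : left_id 1 clscale.
Proof. by move=> x; apply: funext => A; exact: mul1r. Qed.
Let clscaleDr : right_distributive clscale +%R.
Proof. by move=> a x y; apply: funext => A; exact: mulrDr. Qed.
Let clscaleDl x : {morph clscale^~ x : a b / a + b}.
Proof. by move=> a b; apply: funext => A; exact: mulrDl. Qed.

HB.instance Definition _ := GRing.Zmodule_isLmodule.Build R (Cl n)
  clscaleA clscale1 clscaleDr clscaleDl.

Let clscaleAl (a : R) x y : a *: (x * y) = (a *: x) * y.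
Proof.
apply: funext => C; rewrite /GRing.mul /GRing.scale /= /clscale !clmulE.
by rewrite [LHS]mulr_sumr; apply: eq_bigr => A _; ring.
Qed.
HB.instance Definition _ := GRing.Lmodule_isLalgebra.Build R (Cl n) clscaleAl.

Let clscaleAr (a : R) x y : a *: (x * y) = x * (a *: y).
Proof.
apply: funext => C; rewrite /GRing.mul /GRing.scale /= /clscale !clmulE.
by rewrite [LHS]mulr_sumr; apply: eq_bigr => A _; ring.
Qed.
HB.instance Definition _ := GRing.Lalgebra_isAlgebra.Build R (Cl n) clscaleAr.

Lemma clE_scale (a : R) x A : (a *: x) A = a * x A. Proof. by []. Qed.
Lemma clE_sum I (r : seq I) P (F : I -> Cl n) A :
  (\sum_(i <- r | P i) F i) A = \sum_(i <- r | P i) F i A.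
Proof. by apply: (big_morph (fun x : Cl n => x A)). Qed.

Lemma clmulM x y : clmul n x y = x * y. Proof. by []. Qed.

End CliffordRing.

(** * Products of unit vectors *)

Section Vectors.
Variable n : nat.
Implicit Types (u v w : 'rV[R]_n) (x y z : Cl n) (p q : bool).

Definition blade (A : {set 'I_n}) : Cl n := fun C => (C == A)%:R.

Lemma bladeM A B : blade A * blade B = clsgn n A B *: blade (symdiff n A B).
Proof.
apply: funext => C; rewrite -clmulM clmulE clE_scale (bigD1 A) //= big1 => [|D /negPf DA].
  rewrite addr0 {1}/blade eqxx mul1r /blade.
  have -> : (C == symdiff n A B) = (symdiff n A C == B).
    by apply/eqP/eqP => [->|<-]; rewrite symdiffK.
  by case: eqP => [->|_] //; rewrite !mulr0.
by rewrite {1}/blade DA mul0r mulr0.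
Qed.

Lemma blade0 : blade set0 = 1.
Proof. by apply: funext => C; rewrite /blade /GRing.one /= /clone; case: eqP. Qed.

Definition dot u v : R := \sum_i u 0 i * v 0 i.

Lemma dotC u v : dot u v = dot v u.
Proof. by apply: eq_bigr => i _; exact: mulrC. Qed.
Lemma dotDl u v w : dot (u + v) w = dot u w + dot v w.
Proof. by rewrite -big_split; apply: eq_bigr => i _; rewrite mxE mulrDl. Qed.
Lemma dotZl (a : R) u v : dot (a *: u) v = a * dot u v.
Proof. by rewrite mulr_sumr; apply: eq_bigr => i _; rewrite mxE mulrA. Qed.
Lemma dotDr u v w : dot w (u + v) = dot w u + dot w v.
Proof. by rewrite dotC dotDl !(dotC w). Qed.
Lemma dotZr (a : R) u v : dot u (a *: v) = a * dot u v.
Proof. by rewrite dotC dotZl dotC. Qed.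
Lemma dotNl u v : dot (- u) v = - dot u v.
Proof. by rewrite -scaleN1r dotZl mulN1r. Qed.
Lemma dotNr u v : dot u (- v) = - dot u v.
Proof. by rewrite dotC dotNl dotC. Qed.
Definition dotE := (dotDl, dotDr, dotNl, dotNr, dotZl, dotZr).

Lemma dot_ge0 u : 0 <= dot u u.
Proof. by apply: sumr_ge0 => i _; rewrite -expr2 sqr_ge0. Qed.
Lemma dot_eq0 u : dot u u = 0 -> u = 0.
Proof.
move=> /eqP; rewrite psumr_eq0 => [/allP u0|i _]; last by rewrite -expr2 sqr_ge0.
apply/rowP=> i; apply/eqP; rewrite mxE -(orbb (_ == 0)) -mulf_eq0.
exact: (u0 i (mem_index_enum i)).
Qed.

Definition basis (i : 'I_n) : 'rV[R]_n := delta_mx 0 i.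

Lemma dot_basis u i : dot u (basis i) = u 0 i.
Proof.
rewrite /dot (bigD1 i) //= big1 => [|j /negPf ji]; rewrite mxE ?ji ?eqxx ?mulr1 ?addr0 //.
by rewrite mulr0.
Qed.

Definition vec u : Cl n := \sum_i u 0 i *: blade [set i].

Lemma vecD u v : vec (u + v) = vec u + vec v.
Proof. by rewrite -big_split; apply: eq_bigr => i _; rewrite mxE scalerDl. Qed.
Lemma vecZ (a : R) u : vec (a *: u) = a *: vec u.
Proof. by rewrite scaler_sumr; apply: eq_bigr => i _; rewrite mxE scalerA. Qed.
Lemma vecN u : vec (- u) = - vec u.
Proof. by rewrite -scaleN1r vecZ scaleN1r. Qed.

Lemma vec_set1 u i : vec u [set i] = u 0 i.
Proof.
rewrite /vec clE_sum (bigD1 i) //= big1 => [|j /negPf ji].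
  by rewrite addr0 clE_scale /blade eqxx mulr1.
by rewrite clE_scale /blade (inj_eq set1_inj) eq_sym ji mulr0.
Qed.

Lemma vec_ncard1 u (C : {set 'I_n}) : #|C| <> 1%N -> vec u C = 0.
Proof.
move=> C1; rewrite /vec clE_sum big1 // => i _; rewrite clE_scale /blade.
by case: eqP => [CE|]; rewrite ?mulr0 //; case: C1; rewrite CE cards1.
Qed.

(** Polarised Clifford relation: when the term (i, j) of one product is paired with (j, i) of the
    other, off-diagonal terms cancel and the diagonal ones give [-2 u_i v_i]. *)
Lemma vec_anticomm u v : vec u * vec v + vec v * vec u = (- (2 * dot u v)) *: 1.
Proof.
have E a b : vec a * vec b = \sum_i \sum_j (a 0 i * b 0 j) *: (blade [set i] * blade [set j]).
  rewrite mulr_suml; apply: eq_bigr => i _; rewrite mulr_sumr; apply: eq_bigr => j _.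
  by rewrite -scalerAl -scalerAr scalerA.
rewrite !E [X in _ + X]exchange_big -big_split /=.
transitivity (\sum_i (- (2 * (u 0 i * v 0 i))) *: (1 : Cl n)); last first.
  by rewrite -scaler_suml sumrN -mulr_sumr.
apply: eq_bigr => i _; rewrite -big_split /= (bigD1 i) //= big1 => [|j ji].
  rewrite addr0 bladeM clsgn11 leqnn (eqP (_ : symdiff n _ _ == set0)) ?symdiff_eq0 //.
  by rewrite blade0 -scalerDl scalerA; congr (_ *: _); rewrite /= expr1; ring.
rewrite !bladeM !clsgn11 symdiffC [v 0 j * _]mulrC !scalerA -scalerDl.
rewrite (_ : _ + _ = 0) ?scale0r //; case: ltngtP => [_|_|/val_inj ij]; rewrite ?expr0 ?expr1; [ring|ring|].
by rewrite ij eqxx in ji.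
Qed.

Lemma vec_sqr u : vec u * vec u = - dot u u *: 1.
Proof.
have /(congr1 ( *:%R 2^-1)) := vec_anticomm u u.
rewrite -mulr2n -scaler_nat !scalerA mulVf ?pnatr_eq0 // scale1r => ->.
by congr (_ *: _); field.
Qed.

Lemma vec_unit_sqr u : dot u u = 1 -> vec u * vec u = -1.
Proof. by rewrite vec_sqr => ->; rewrite scaleN1r. Qed.

(** * Unit vectors supported in an interval of coordinates, and their products *)

Definition supp a b u := forall i : 'I_n, ~~ (a <= i < b)%N -> u 0 i = 0.

Lemma suppD a b u v : supp a b u -> supp a b v -> supp a b (u + v).
Proof. by move=> Su Sv i ab; rewrite mxE Su ?Sv ?addr0. Qed.
Lemma suppZ a b c u : supp a b u -> supp a b (c *: u).
Proof. by move=> Su i ab; rewrite mxE Su ?mulr0. Qed.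
Lemma suppN a b u : supp a b u -> supp a b (- u).
Proof. by move=> Su i ab; rewrite mxE Su ?oppr0. Qed.
Lemma supp_basis a b (i : 'I_n) : (a <= i < b)%N -> supp a b (basis i).
Proof. by move=> ab j; rewrite mxE /=; case: eqP => // ->; rewrite ab. Qed.
Lemma supp_mono a b a' b' u : (a' <= a)%N -> (b <= b')%N -> supp a b u -> supp a' b' u.
Proof. by move=> aa bb Su i ab; apply: Su; lia. Qed.
Lemma supp_pred a (k : 'I_n) u : supp a k.+1 u -> u 0 k = 0 -> supp a k u.
Proof.
move=> Su uk i ik; case: (eqVneq i k) => [->//|/eqP nik]; apply: Su.
have : (i : nat) <> k by move/val_inj.
by move: ik; lia.
Qed.
Lemma dot_disjoint a b c d u v : (b <= c)%N -> supp a b u -> supp c d v -> dot u v = 0.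
Proof.
move=> bc Su Sv; apply: big1 => i _; case: (ltnP i b) => ib.
  by rewrite [v 0 i]Sv ?mulr0 //; lia.
by rewrite Su ?mul0r //; lia.
Qed.
Lemma dot_basis1 i : dot (basis i) (basis i) = 1.
Proof. by rewrite dot_basis mxE !eqxx. Qed.

Definition uvec a b x := exists u, [/\ dot u u = 1, supp a b u & x = vec u].

(** The Boolean is the parity of the number of factors. Keeping odd products as well, that is the
    Pin group, allows inductions that strip one vector at a time. *)
Inductive pin a b : bool -> Cl n -> Prop :=
| pin_one : pin a b false 1
| pin_cons p x y : uvec a b x -> pin a b p y -> pin a b (~~ p) (x * y).

(* Spin on e_(a+1), ..., e_b in the paper's 1-based numbering. *)
Definition spin a b x := pin a b false x.

Lemma uvecN a b x : uvec a b x -> uvec a b (- x).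
Proof.
move=> [u [u1 Su ->]]; exists (- u); split; [|exact: suppN|by rewrite vecN].
by rewrite !dotE opprK.
Qed.
Lemma uvec_sqr a b x : uvec a b x -> x * x = -1.
Proof. by move=> [u [u1 _ ->]]; exact: vec_unit_sqr. Qed.
Lemma uvec_basis a b (i : 'I_n) : (a <= i < b)%N -> uvec a b (vec (basis i)).
Proof. by move=> ab; exists (basis i); split; rewrite ?dot_basis1 //; exact: supp_basis. Qed.

Lemma pin_uvec a b x : uvec a b x -> pin a b true x.
Proof. by move=> ux; rewrite -[x]mulr1; exact: (@pin_cons a b false _ _ ux (pin_one a b)). Qed.

Lemma pinM a b p q x y : pin a b p x -> pin a b q y -> pin a b (p (+) q) (x * y).
Proof.
elim=> [|{}p {x} u x uu _ IH] py; first by rewrite mul1r.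
by rewrite -mulrA addNb; apply: pin_cons => //; exact: IH.
Qed.
Lemma spinM a b x y : spin a b x -> spin a b y -> spin a b (x * y).
Proof. exact: (@pinM a b false false). Qed.
Lemma spin1 a b : spin a b 1. Proof. exact: pin_one. Qed.
Lemma spin_uu a b x y : uvec a b x -> uvec a b y -> spin a b (x * y).
Proof. by move=> /pin_uvec px /pin_uvec py; exact: (pinM px py). Qed.

(** Reverse the product and negate each factor, since a unit vector has square [-1]. *)
Lemma pinV a b p x : pin a b p x -> exists y, [/\ pin a b p y, x * y = 1 & y * x = 1].
Proof.
elim=> [|{}p {x} u x uu _ [y [py xy yx]]]; first by exists 1; rewrite mulr1; split=> //; exact: pin_one.
exists (y * - u); split.
- by have := pinM py (pin_uvec (uvecN uu)); rewrite addbT.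
- by rewrite -mulrA (mulrA x) xy mul1r mulrN (uvec_sqr uu) opprK.
by rewrite mulrA -(mulrA y) mulNr (uvec_sqr uu) opprK mulr1.
Qed.

Lemma uvec_mono a b a' b' x : (a' <= a)%N -> (b <= b')%N -> uvec a b x -> uvec a' b' x.
Proof. by move=> aa bb [u [u1 Su ->]]; exists u; split=> //; exact: (supp_mono aa bb). Qed.
Lemma pin_mono a b a' b' p x : (a' <= a)%N -> (b <= b')%N -> pin a b p x -> pin a' b' p x.
Proof.
move=> aa bb; elim=> [|{}p {x} u x uu _ IH]; first exact: pin_one.
by apply: pin_cons => //; exact: (uvec_mono aa bb).
Qed.

Lemma uvec_anticomm a b c d x y : (b <= c)%N -> uvec a b x -> uvec c d y -> x * y = - (y * x).
Proof.
move=> bc [u [_ Su ->]] [v [_ Sv ->]]; apply/eqP; rewrite -addr_eq0 vec_anticomm.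
by rewrite (dot_disjoint bc Su Sv) mulr0 oppr0 scale0r.
Qed.
(** The vector [y] is orthogonal to every factor of [x], so passing each of them costs one sign. *)
Lemma uvec_pin_comm a b c d p x y : (b <= c)%N -> pin a b p x -> uvec c d y ->
  x * y = (-1) ^+ p * (y * x).
Proof.
move=> bc px uy; elim: px => [|{}p {x} u x uu _ IH]; first by rewrite mulr1 !mul1r.
have yu := uvec_anticomm bc uu uy.
rewrite -mulrA IH; case: p {IH}; rewrite /= ?expr0 ?expr1 ?mulN1r ?mul1r ?mulrN !mulrA yu.
  by rewrite mulNr opprK.
by rewrite mulNr.
Qed.

Lemma spin_uvec_comm a b c d x y : (b <= c)%N -> spin a b x -> uvec c d y -> x * y = y * x.
Proof. by move=> bc px uy; rewrite (uvec_pin_comm bc px uy) mul1r. Qed.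

Lemma spin_comm a b c d x y : (b <= c)%N -> spin a b x -> spin c d y -> x * y = y * x.
Proof.
move=> bc px; rewrite /spin; move: false => p; elim=> [|{}p u {}y uu _ IH]; first by rewrite mulr1 mul1r.
by rewrite mulrA (spin_uvec_comm bc px uu) -mulrA IH mulrA.
Qed.

(** * Decompositions of Spin from its action on unit vectors *)

Lemma ord_between a (k : 'I_n) : (a < k)%N -> exists j : 'I_n, (a <= j < k)%N.
Proof. by move=> ak; exists (Ordinal (ltn_trans ak (ltn_ord k))); rewrite leqnn. Qed.

Lemma unit_normalize u : u != 0 -> exists r : R, [/\ 0 < r, r * r = dot u u &
  dot (r^-1 *: u) (r^-1 *: u) = 1].
Proof.
move=> u0; have d0 : 0 < dot u u.
  by rewrite lt_def dot_ge0 andbT; apply: contra u0 => /eqP /dot_eq0 ->.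
exists (Num.sqrt (dot u u)); split; first by rewrite sqrtr_gt0.
  by rewrite -expr2 sqr_sqrtr // ltW.
by rewrite !dotE mulrA -invfM -expr2 sqr_sqrtr ?mulVf ?gt_eqF ?ltW.
Qed.

(* The plane of [u] and [v] meets the hyperplane orthogonal to [basis k] in a unit vector [w],
   and the rotation [u v] can be written [v' w] inside that plane. *)
Lemma uvec_mul_hyperplane a (k : 'I_n) x y : (a < k)%N -> uvec a k.+1 x -> uvec a k.+1 y ->
  exists x' y', [/\ uvec a k.+1 x', uvec a k y' & x * y = x' * y'].
Proof.
move=> ak [u [u1 Su ->]] [v [v1 Sv ->]].
have [vk0|vk0] := eqVneq (v 0 k) 0.
  exists (vec u), (vec v); split=> //; first by exists u.
  by exists v; split=> //; exact: supp_pred.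
pose w := v 0 k *: u - u 0 k *: v.
have Sw : supp a k w.
  apply: supp_pred; last by rewrite !mxE mulrC subrr.
  by apply: suppD; [exact: suppZ|apply: suppN; exact: suppZ].
(* If [w = 0], then [u = t *: v] with [t * t = 1], and the product is the scalar [- t]. The vectors
   [t *: basis j] and [basis j] have the same product. *)
have [w0|w0] := eqVneq w 0.
  have uv : u = (u 0 k / v 0 k) *: v.
    have vu : v 0 k *: u = u 0 k *: v by apply/eqP; rewrite -subr_eq0 -/w w0.
    by rewrite mulrC -scalerA -vu scalerA mulVf // scale1r.
  move: (u 0 k / v 0 k) uv => t uv.
  have tt : t * t = 1 by move: u1; rewrite uv !dotE v1 mulr1.
  have [j aj] := ord_between ak.
  exists (vec (t *: basis j)), (vec (basis j)).
  split; last 1 first.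
  - by rewrite uv !vecZ -!scalerAl !vec_unit_sqr // dot_basis1.
  - exists (t *: basis j); split=> //.
      by rewrite !dotE dot_basis1 mulr1.
    by apply: suppZ; apply: supp_basis; move: aj; lia.
  - exact: uvec_basis.
have [r [r0 rr wn1]] := unit_normalize w0.
move: (wn1); set w' := r^-1 *: w => w'1.
pose al := r^-1 * v 0 k; pose be := - (r^-1 * u 0 k).
have wE : w' = al *: u + be *: v by rewrite /w' /w scalerBr !scalerA scaleNr.
(* This is [- u v w'] expanded with [u v u = v - 2 (u.v) u], hence again a vector. Multiplying it by
   [w'], whose square is [-1], returns [u v]. *)
pose v' := be *: u - al *: (v - (2 * dot u v) *: u).
exists (vec v'), (vec w'); split.
- exists v'; split=> //.
    move: w'1; rewrite wE /v' !dotE (dotC v u) u1 v1 => w'1; apply: etrans w'1; ring.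
  apply: suppD; first exact: suppZ.
  by apply: suppN; apply: suppZ; apply: suppD => //; apply: suppN; exact: suppZ.
- by exists w'; split=> //; exact: suppZ.
have v'E : vec v' = - (vec u * vec v * vec w').
  have vu : vec v * vec u = - (vec u * vec v) - (2 * dot u v) *: 1.
    by rewrite -scaleNr -vec_anticomm addKr.
  have uvu : vec u * vec v * vec u = vec (v - (2 * dot u v) *: u).
    rewrite -mulrA vu mulrDr !mulrN mulrA (vec_unit_sqr u1) mulN1r opprK.
    by rewrite vecD vecN vecZ -scalerAr mulr1.
  rewrite /v' vecD vecN (vecZ al) -uvu wE vecD !vecZ mulrDr -!scalerAr.
  rewrite -(mulrA _ (vec v) (vec v)) (vec_unit_sqr v1).
  by rewrite mulrN1 scalerN opprD opprK addrC.
by rewrite v'E mulNr -(mulrA _ (vec w') (vec w')) (vec_unit_sqr w'1) mulrN1 opprK.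
Qed.

(** Induction on the factors: a new factor and the current [v] are traded for [v' * w] with [w] in
    the hyperplane of the first coordinates, and [w] is absorbed into [y]. *)
Lemma pin_decomp a (k : 'I_n) p x : (a < k)%N -> pin a k.+1 p x ->
  exists (v y : Cl n), [/\ uvec a k.+1 v, pin a k (~~ p) y & x = v * y].
Proof.
move=> ak; have [j aj] := ord_between ak.
elim=> [|{}p u {}x uu _ [v [y [uv py ->]]]].
  have ub := uvec_basis aj; have ub' : uvec a k.+1 (vec (basis j)).
    exact: (uvec_mono _ _ ub).
  exists (- vec (basis j)), (vec (basis j)).
  split; [exact: uvecN|exact: pin_uvec|].
  by rewrite mulNr (uvec_sqr ub) opprK.
have [v' [w [uv' uw E]]] := uvec_mul_hyperplane ak uu uv.
by exists v', (w * y); split=> //; [exact: pin_cons|rewrite mulrA E -mulrA].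
Qed.

(* With [h] the unit vector bisecting [w] and [basis k], conjugation by [h * basis k] is the
   rotation of their plane taking [basis k] to [w]; if [w = - basis k] rotate in another plane. *)
Lemma spin_transitive a (k : 'I_n) w : (a < k)%N -> dot w w = 1 -> supp a k.+1 w ->
  exists2 g, spin a k.+1 g & g * vec (basis k) = vec w * g.
Proof.
move=> ak w1 Sw; have [j aj] := ord_between ak.
have f1 := dot_basis1 k; have Sf : supp a k.+1 (basis k) by apply: supp_basis; lia.
have uf : uvec a k.+1 (vec (basis k)) by exists (basis k).
have ff := vec_unit_sqr f1.
have [wf|wf] := eqVneq (w + basis k) 0.
  set e := vec (basis j).
  have ue : uvec a k e by exact: uvec_basis.
  exists (e * vec (basis k)); first by apply: spin_uu => //; exact: (uvec_mono _ _ ue).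
  have -> : w = - basis k by apply/eqP; rewrite -addr_eq0 wf.
  have uk : uvec k k.+1 (vec (basis k)) by apply: uvec_basis; lia.
  by rewrite vecN mulNr mulrA (uvec_anticomm (leqnn k) ue uk) mulNr.
have [r [r0 _ h1]] := unit_normalize wf.
set h := r^-1 *: _ in h1.
exists (vec h * vec (basis k)).
  apply: spin_uu => //; exists h; split=> //.
  by apply: suppZ; exact: suppD.
(* Since [w] and [basis k] square to [-1], both sides are the same multiple of [- (w + basis k)]. *)
rewrite -mulrA ff mulrN1 /h vecZ vecD -!scalerAl -scalerAr -scalerN; congr (_ *: _).
by rewrite mulrDl mulrDr ff mulrA (vec_unit_sqr w1) mulN1r mulrN1 opprD addrC.
Qed.

Lemma uvec_split a (k : 'I_n) v : (a < k)%N -> dot v v = 1 -> supp a k.+1 v ->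
  exists c r w, [/\ c * c + r * r = 1, dot w w = 1, supp a k w & v = c *: basis k + r *: w].
Proof.
move=> ak v1 Sv; pose v0 := v - v 0 k *: basis k.
have Sv0 : supp a k v0.
  apply: supp_pred; last by rewrite !mxE !eqxx mulr1 subrr.
  by apply: suppD => //; apply: suppN; apply: suppZ; apply: supp_basis; lia.
have vE : v = v 0 k *: basis k + v0 by rewrite /v0 addrCA subrr addr0.
have E : v 0 k * v 0 k + dot v0 v0 = 1.
  by rewrite -[RHS]v1 /v0 !dotE (dotC (basis k) v) dot_basis1 !dot_basis; ring.
(* If [v] is a multiple of [basis k], any unit vector below [k] serves as [w], with [r = 0]. *)
have [v00|v00] := eqVneq v0 0.
  have [j aj] := ord_between ak.
  exists (v 0 k), 0, (basis j); split.
  - by rewrite -[RHS]E v00 -(scale0r v0) !dotE !mul0r.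
  - exact: dot_basis1.
  - exact: supp_basis.
  - by rewrite scale0r -v00.
have [r [r0 rr w1]] := unit_normalize v00.
exists (v 0 k), r, (r^-1 *: v0); split=> //; first by rewrite rr.
  exact: suppZ.
by rewrite scalerA mulfV ?scale1r // gt_eqF.
Qed.

(** Write [x = v * y] by [pin_decomp], with [v = c e_k + r w]. Some [g] on the coordinates below [k]
    rotates [basis j] to [w] and fixes [basis k], so [v = g t g^-1] with [t = c e_k + r e_j], which
    involves the last two coordinates only. *)
Lemma spin_KAK a (j k : 'I_n) x : (a < j)%N -> k = j.+1 :> nat -> spin a k.+1 x ->
  exists g s h, [/\ spin a k g, spin j k.+1 s, spin a k h & x = g * s * h].
Proof.
move=> aj kj; have ak : (a < k)%N by lia.
case/(pin_decomp ak) => _ [y [[v [v1 Sv ->]] py ->]].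
have [c [r [w [cr w1 Sw ->]]]] := uvec_split ak v1 Sv.
have [g pg gw] : exists2 g, spin a k g & g * vec (basis j) = vec w * g.
  by rewrite kj; apply: spin_transitive => //; rewrite -kj.
have [g' [pg' gg' g'g]] := pinV pg.
set f := vec (basis j) in gw *; set e := vec (basis k).
have uf : uvec j k f by apply: uvec_basis; lia.
have ue : uvec k k.+1 e by apply: uvec_basis; lia.
have ge : g * e = e * g := spin_uvec_comm (leqnn k) pg ue.
pose t := c *: e + r *: f.
have ut : uvec j k.+1 t.
  exists (c *: basis k + r *: basis j); rewrite vecD !vecZ; split=> //.
    have kj0 : dot (basis j) (basis k) = 0.
      by rewrite dot_basis mxE /= (_ : (k == j) = false) ?andbF //; apply/eqP => kj'; rewrite kj' in kj; lia.
    by rewrite !dotE (dotC (basis k)) !kj0 !dot_basis1 -[RHS]cr; ring.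
  by apply: suppD; apply: suppZ; apply: supp_basis; lia.
(* Both [t] and [y] are odd; inserting [- f * f = 1] after [t] makes the middle and the right factor
   even. *)
exists g, (t * - f), (f * g' * y); split=> //.
- apply: spin_uu => //; apply: (uvec_mono _ _ (uvecN uf)) => //; lia.
- have pf : pin a k true f by apply: pin_uvec; apply: (uvec_mono _ _ uf) => //; lia.
  by have := pinM (pinM pf pg') py.
have -> : g * (t * - f) * (f * g' * y) = g * t * (- (f * f)) * g' * y by rewrite !mulrN !mulNr !mulrA.
rewrite (uvec_sqr uf) opprK mulr1; congr (_ * _).
have -> : g * t = vec (c *: basis k + r *: w) * g.
  by rewrite vecD !vecZ mulrDr mulrDl -!scalerAr -!scalerAl ge gw.
by rewrite -mulrA gg' mulr1.
Qed.

(** Being even and supported below [k], [x] commutes with [basis k]. In [x = v * y] the odd factor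
    [y] anticommutes with it, hence so does [v]; thus [v] is orthogonal to [basis k]. *)
Lemma spin_inter a (j k : 'I_n) x : k = j.+1 :> nat -> spin a k x -> spin j k.+1 x -> spin j k x.
Proof.
move=> kj px; have jk : (j < k)%N by lia.
case/(pin_decomp jk) => _ [y [[v [v1 Sv ->]] py xE]].
set e := vec (basis k); have ue : uvec k k.+1 e by apply: uvec_basis; lia.
have xe := spin_uvec_comm (leqnn k) px ue.
have ye := uvec_pin_comm (leqnn k) py ue; rewrite expr1 in ye.
have [y' [_ yy' _]] := pinV py.
have ve : vec v * e = - (e * vec v).
  have : vec v * y * e * y' = e * vec v * y * y' by rewrite -xE xe xE !mulrA.
  rewrite -!mulrA yy' mulr1 (mulrA y) ye mulN1r mulNr -mulrA yy' mulr1 mulrN => <-.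
  by rewrite opprK.
rewrite /spin xE; apply: (@pin_cons _ _ true) => //; exists v; split=> //; apply: supp_pred => //.
move/eqP: ve; rewrite -addr_eq0 vec_anticomm scaler_eq0 oner_eq0 orbF oppr_eq0 mulf_eq0.
by rewrite dot_basis pnatr_eq0 => /eqP.
Qed.

End Vectors.

(** * Gluing homomorphisms *)

Section Gluing.
Variables (X : nzRingType) (G : groupType).
Variables (K M A B T : X -> Prop) (f t : X -> G).

Definition mul_closed (P : X -> Prop) := forall x y, P x -> P y -> P (x * y).
Definition inv_closed (P : X -> Prop) :=
  forall x, P x -> exists y, [/\ P y, x * y = 1 & y * x = 1].
Definition multiplicative_on (P : X -> Prop) (h : X -> G) :=
  forall x y, P x -> P y -> h (x * y) = (h x * h y)%g.

Hypotheses (K1 : K 1) (A1 : A 1).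
Hypotheses (KM : mul_closed K) (TM : mul_closed T).
Hypotheses (KV : inv_closed K) (AV : inv_closed A).
Hypotheses (fM : multiplicative_on K f) (tM : multiplicative_on T t).
Hypotheses (MK : forall x, M x -> K x) (BK : forall x, B x -> K x).
Hypotheses (AT : forall x, A x -> T x) (BT : forall x, B x -> T x).
Hypothesis ft : forall x, B x -> f x = t x.
Hypothesis KAB : forall x, K x -> A x -> B x.
Hypothesis K_MBM : forall x, K x -> exists m b m', [/\ M m, B b, M m' & x = m * b * m'].
Hypothesis T_BAB : forall x, T x -> exists b a b', [/\ B b, A a, B b' & x = b * a * b'].
Hypothesis MA : forall m a, M m -> A a -> m * a = a * m.
(** [M] lies in the domain of [f] and [A] in that of [t], so commutation of the images is a separate
    condition. For the amalgam it comes from the edges of non-adjacent vertices. *)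
Hypothesis fMtA : forall m a, M m -> A a -> commute (f m) (t a).

(** The graph of the map to be constructed, stated before it is known to be single-valued. *)
Definition glue_rel (x : X) (g : G) := exists k a l,
  [/\ K k, A a, K l, x = k * a * l & g = (f k * t a * f l)%g].

Let f1 : f 1 = 1%g.
Proof. by apply: (mulgI (f 1)); rewrite -fM // mulr1 mulg1. Qed.
Let t1 : t 1 = 1%g.
Proof. by apply: (mulgI (t 1)); rewrite -tM ?mulr1 ?mulg1 //; exact: AT. Qed.

Lemma glue_relK x g k : glue_rel x g -> K k -> glue_rel (x * k) (g * f k).
Proof.
move=> [l [a [l' [Kl Aa Kl' -> ->]]]] Kk; exists l, a, (l' * k); split=> //; first exact: KM.
  by rewrite !mulrA.
by rewrite fM // !mulgA.
Qed.

(* Writing [l = m b m'], the factors of [M] move past [A] and [a b a'] lies in [T = B A B]. *)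
Lemma glue_relA x g a : glue_rel x g -> A a -> glue_rel (x * a) (g * t a).
Proof.
move=> [k [a0 [l [Kk Aa0 Kl -> ->]]]] Aa.
have [m [b [m' [Mm Bb Mm' lE]]]] := K_MBM Kl.
have [Ta0 Ta Tb] : [/\ T a0, T a & T b] by split; [exact: AT|exact: AT|exact: BT].
have [Km Kb Km'] : [/\ K m, K b & K m'] by split; [exact: MK|exact: BK|exact: MK].
have [c [a' [c' [Bc Aa' Bc' E]]]] := T_BAB (TM (TM Ta0 Tb) Ta).
have [Kc Kc'] : K c /\ K c' by split; exact: BK.
have [Tc Tc' Ta'] : [/\ T c, T c' & T a'] by split; [exact: BT|exact: BT|exact: AT].
exists (k * m * c), a', (c' * m'); split=> //; try by do ?apply: KM.
  transitivity (k * (a0 * m) * b * (m' * a)); first by rewrite lE !mulrA.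
  rewrite -(MA Mm Aa0) (MA Mm' Aa).
  by transitivity (k * m * (a0 * b * a) * m'); [rewrite !mulrA|rewrite E !mulrA].
rewrite lE !fM ?(ft Bc) ?(ft Bc') ?(ft Bb); try by do ?apply: KM.
have tE : (t a0 * t b * t a = t c * t a' * t c')%g by rewrite -!tM ?E //; exact: TM.
transitivity (f k * (t a0 * f m) * t b * (f m' * t a))%g; first by rewrite !mulgA.
rewrite -(fMtA Mm Aa0) (fMtA Mm' Aa).
by transitivity (f k * f m * (t a0 * t b * t a) * f m')%g; [rewrite !mulgA|rewrite tE !mulgA].
Qed.

Lemma glue_relM x y g h : glue_rel x g -> glue_rel y h -> glue_rel (x * y) (g * h).
Proof.
move=> Rx [k [a [l [Kk Aa Kl -> ->]]]]; rewrite !mulrA !mulgA.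
by apply: glue_relK => //; apply: glue_relA => //; exact: glue_relK.
Qed.

Let fV x y : K x -> K y -> x * y = 1 -> f y = (f x)^-1%g.
Proof. by move=> Kx Ky xy; apply: (mulgI (f x)); rewrite -fM // xy f1 mulgV. Qed.
Let tV x y : A x -> A y -> x * y = 1 -> t y = (t x)^-1%g.
Proof. by move=> Ax Ay xy; apply: (mulgI (t x)); rewrite -tM ?xy ?t1 ?mulgV //; exact: AT. Qed.

Lemma glue_relV x g : glue_rel x g -> exists2 y, y * x = 1 & glue_rel y g^-1.
Proof.
move=> [k [a [l [Kk Aa Kl -> ->]]]].
have [k' [Kk' kk' k'k]] := KV Kk; have [l' [Kl' ll' l'l]] := KV Kl.
have [a' [Aa' aa' a'a]] := AV Aa; exists (l' * a' * k').
  by rewrite !mulrA -(mulrA _ k') k'k mulr1 -(mulrA _ a') a'a mulr1 l'l.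
exists l', a', k'; split=> //.
by rewrite (fV Kk Kk' kk') (fV Kl Kl' ll') (tV Aa Aa' aa') !invgM !mulgA.
Qed.

(** From [k * a * l = 1] the factor [a] lies in [K] as well, hence in [B], where [t a = f a]; the
    value is then [f (k * a * l) = f 1]. *)
Lemma glue_rel_one g : glue_rel 1 g -> g = 1%g.
Proof.
move=> [k [a [l [Kk Aa Kl E ->]]]].
have [k' [Kk' kk' k'k]] := KV Kk; have [l' [Kl' ll' l'l]] := KV Kl.
have aE : a = k' * l'.
  by rewrite -[LHS]mul1r -k'k -[LHS]mulr1 -ll' -!mulrA (mulrA a) (mulrA k) (mulrA k) -E mul1r.
have Ka : K a by rewrite aE; exact: KM.
by rewrite -(ft (KAB Ka Aa)) -!fM -?E //; exact: KM.
Qed.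

Lemma glue_rel_fun x g h : glue_rel x g -> glue_rel x h -> g = h.
Proof.
move=> Rg /glue_relV [y yx Ry]; have := glue_relM Ry Rg; rewrite yx => /glue_rel_one.
by move/(congr1 (fun z => h * z)%g); rewrite mulgA mulgV mul1g mulg1.
Qed.

Lemma glue : exists r : X -> G,
  [/\ multiplicative_on (fun x => exists k a l, [/\ K k, A a, K l & x = k * a * l]) r,
      forall x, K x -> r x = f x & forall x, A x -> r x = t x].
Proof.
(* The value is chosen from the relation; outside its domain it is 1 by default. *)
pose r x := if pselect (exists g, glue_rel x g) is left e then projT1 (cid e) else 1%g.
have rP x g : glue_rel x g -> r x = g.
  move=> Rx; rewrite /r; case: pselect => [e|[]]; last by exists g.
  by case: cid => h Rh /=; exact: glue_rel_fun Rh Rx.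
have dec x : (exists k a l, [/\ K k, A a, K l & x = k * a * l]) -> exists g, glue_rel x g.
  by move=> [k [a [l [Kk Aa Kl ->]]]]; exists (f k * t a * f l)%g, k, a, l.
exists r; split=> [x y /dec [g Rg] /dec [h Rh]|x Kx|x Ax].
- by rewrite (rP _ _ (glue_relM Rg Rh)) (rP _ _ Rg) (rP _ _ Rh).
- by apply: rP; exists x, 1, 1; rewrite !mulr1 f1 t1 !mulg1.
- by apply: rP; exists 1, x, 1; rewrite mulr1 mul1r f1 mulg1 mul1g.
Qed.

End Gluing.

(** * Generation of Spin by the Spin(2) of consecutive coordinate planes *)

Section Generation.
Variable n : nat.

Lemma spin_KAK_nat a k (x : Cl n) : (a.+1 < k < n)%N -> spin a k.+1 x ->
  exists g s h, [/\ spin a k g, spin k.-1 k.+1 s, spin a k h & x = g * s * h].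
Proof.
case/andP => ak kn; have jn : (k.-1 < n)%N by lia.
by apply: (@spin_KAK n a (Ordinal jn) (Ordinal kn)) => /=; lia.
Qed.

(** [spin_KAK_nat] splits off the last plane and leaves two factors on one coordinate fewer, to
    which induction on [b] applies. *)
Lemma spin_gen_ind a b (P : Cl n -> Prop) : (a + 2 <= b <= n)%N ->
  (forall j x, (a <= j)%N -> (j + 2 <= b)%N -> spin j j.+2 x -> P x) ->
  (forall x y, spin a b x -> spin a b y -> P x -> P y -> P (x * y)) ->
  forall x, spin a b x -> P x.
Proof.
elim: b => [|b IH]; first by lia.
move=> /andP[ab bn] PS PM x sx.
have [ba|ba] := eqVneq b a.+1.
  by rewrite ba in sx *; apply: (PS a) => //; lia.
have {}IH y : spin a b y -> P y.
  move=> sy; apply: IH sy; first by lia.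
    by move=> j z aj jb; apply: PS => //; lia.
  by move=> z w sz sw; apply: PM; [apply: pin_mono sz|apply: pin_mono sw]; lia.
have [|g [s [h [sg ss sh ->]]]] := spin_KAK_nat _ sx; first by lia.
have [g' s' h'] : [/\ spin a b.+1 g, spin a b.+1 s & spin a b.+1 h].
  by split; [apply: pin_mono sg|apply: pin_mono ss|apply: pin_mono sh]; lia.
have Ps : P s by apply: (PS b.-1); [lia|lia|rewrite (_ : b.-1.+2 = b.+1) //; lia].
by apply: (PM) => //; [exact: spinM|apply: (PM) => //; exact: IH|exact: IH].
Qed.

End Generation.

(** * Extension of compatible maps along the path diagram *)

Section PathAmalgam.
(** Vertex maps [s i] and edge maps [t i] are read on the subgroups of [Cl n] whose first coordinate
    is [i], counted from 0, so that all domains lie in one ring. *)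
Variables (n : nat) (G : groupType) (s t : nat -> Cl n -> G).
Hypothesis tM : forall i, (i + 3 <= n)%N -> multiplicative_on (spin i i.+3) (t i).
Hypothesis tL : forall i x, (i + 3 <= n)%N -> spin i i.+2 x -> t i x = s i x.
Hypothesis tR : forall i x, (i + 3 <= n)%N -> spin i.+1 i.+3 x -> t i x = s i.+1 x.
Hypothesis s_comm : forall i j x y, (i.+1 < j)%N -> (j + 2 <= n)%N ->
  spin i i.+2 x -> spin j j.+2 y -> commute (s i x) (s j y).

(** Commuting with a fixed element is stable under products, so it suffices to check the generating
    planes, where [s_comm] applies. *)
Lemma path_amalgam_comm k m (p : Cl n -> G) : multiplicative_on (spin 0 k) p ->
  (forall j x, (j + 2 <= k)%N -> spin j j.+2 x -> p x = s j x) -> (k <= n)%N ->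
  (2 <= m <= k)%N -> forall j x y, (m <= j)%N -> (j + 2 <= n)%N ->
  spin 0 m x -> spin j j.+2 y -> commute (p x) (s j y).
Proof.
move=> pM ps kn /andP[m2 mk] j x y mj jn sx sy; move: x sx; apply: spin_gen_ind; first by lia.
  by move=> i x _ im sx; rewrite (ps i) //; [apply: s_comm => //; lia|lia].
move=> x x' sx sx' cx cx'; rewrite pM; last 2 first.
- by apply: pin_mono sx.
- by apply: pin_mono sx'.
by apply/commute_sym/commuteM; exact/commute_sym.
Qed.

Lemma path_amalgam_extend k : (3 <= k <= n)%N -> exists p : Cl n -> G,
  multiplicative_on (spin 0 k) p /\
  (forall j x, (j + 2 <= k)%N -> spin j j.+2 x -> p x = s j x).
Proof.
elim: k => // k IH /andP[k3 kn].
have [k2|k2] := eqVneq k 2%N.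
  (* Base case Spin(3): the first edge map already is the required homomorphism. *)
  rewrite k2 in kn *; exists (t 0%N); split; first exact: tM.
  by move=> [|[|j]] x /= jk sx; [exact: tL|exact: tR|lia].
have k2E : k.-2.+2 = k by lia.
have k1E : k.-1.+1 = k by lia.
have k21 : k.-2.+1 = k.-1 by lia.
have tA x : spin k.-1 k.+1 x -> t k.-2 x = s k.-1 x.
  by move=> sx; rewrite -k21 tR ?k21 //; [lia|rewrite k1E].
have [|p [pM ps]] := IH; first by lia.
(* The sets are [K], [M], [A], [B], [T] in this order. The edge map [t k.-2] joins the last plane of
   [K] to the new plane [A]. *)
have [||||||||||||||||||r [rM rK rA]] := @glue (Cl n) G (spin 0 k) (spin 0 k.-1)
  (spin k.-1 k.+1) (spin k.-2 k) (spin k.-2 k.+1) p (t k.-2).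
all: try by [exact: spin1|move=> ? ?; exact: spinM|move=> ?; exact: pinV].
- exact: pM.
- by have := @tM k.-2; rewrite k2E; apply; lia.
- by move=> x; apply: pin_mono; lia.
- by move=> x; apply: pin_mono; lia.
- by move=> x; apply: pin_mono; lia.
- by move=> x; apply: pin_mono; lia.
- move=> x sx; rewrite (ps k.-2) ?tL ?k2E //; lia.
(* An element of [K] and [A] is supported on the single coordinate [k.-1], which belongs to [B]. *)
- move=> x sx sx'; have kn' : (k < n)%N by lia.
  have jn : (k.-1 < n)%N by lia.
  apply: (@pin_mono n k.-1 k); [lia|lia|].
  apply: (@spin_inter n 0 (Ordinal jn) (Ordinal kn')) => //=; lia.
- move=> x sx; have := @spin_KAK_nat n 0 k.-1 x; rewrite k1E.
  by apply; rewrite //; lia.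
- by move=> x sx; have := @spin_KAK_nat n k.-2 k x; apply; rewrite //; lia.
- by move=> m a; exact: spin_comm.
- move=> m a sm sa.
  by rewrite tA //; apply: (path_amalgam_comm pM ps) sm _; rewrite ?k1E //; lia.
exists r; split.
- move=> x y sx sy; apply: rM; apply: spin_KAK_nat => //; lia.
(* Planes inside the first [k] coordinates are handled by [K]; the only other one is [A]. *)
- move=> j x jk sx; have [jk'|jk'] := leqP (j + 2) k.
    by rewrite rK ?(ps j) //; apply: pin_mono sx; lia.
  have jE : j = k.-1 by lia.
  by move: sx; rewrite jE k1E => sx; rewrite rA ?tA.
Qed.

Lemma path_amalgam_hom : (3 <= n)%N -> exists p : Cl n -> G,
  [/\ multiplicative_on (spin 0 n) p,
      forall j x, (j + 2 <= n)%N -> spin j j.+2 x -> p x = s j x &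
      forall i x, (i + 3 <= n)%N -> spin i i.+3 x -> p x = t i x].
Proof.
move=> n3; have [|p [pM ps]] := @path_amalgam_extend n; first by rewrite n3 leqnn.
(* Agreement with [t i] follows from agreement with [s], since the two coordinate planes of an edge
   generate its Spin(3). *)
exists p; split=> // i x i3; move: x; apply: spin_gen_ind; first by lia.
  move=> j x ij ji sx; rewrite (ps j) //; last by lia.
  have [E|E] : j = i \/ j = i.+1 by lia.
    by rewrite E in sx *; rewrite tL.
  by rewrite E in sx *; rewrite tR.
move=> x y sx sy px py.
by rewrite tM // -px -py pM //; [apply: pin_mono sx|apply: pin_mono sy]; lia.
Qed.

End PathAmalgam.

(** * The embeddings induced by shifts of the indices *)

Lemma cl_blade_sum n (x : Cl n) : x = \sum_A x A *: blade A.
Proof.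
apply: funext => C; rewrite clE_sum (bigD1 C) //= big1 => [|A AC].
  by rewrite addr0 clE_scale /blade eqxx mulr1.
by rewrite clE_scale /blade eq_sym (negPf AC) mulr0.
Qed.

Section Embedding.
Variables (m n a : nat) (phi : 'I_m -> 'I_n).
Hypothesis phiE : forall i, phi i = (a + i)%N :> nat.
Implicit Types (A B : {set 'I_m}) (x y : Cl m) (u : 'rV[R]_m).

(** The linear extension of the index map on blades; products are easier to compute in this form
    than with the coefficientwise [eps]. *)
Definition emb x : Cl n := \sum_A x A *: blade (phi @: A).

Lemma phi_inj : injective phi.
Proof. by move=> i j /(congr1 val) /=; rewrite !phiE => /addnI /val_inj. Qed.

Lemma emb_sum I (r : seq I) P (F : I -> Cl m) :
  emb (\sum_(i <- r | P i) F i) = \sum_(i <- r | P i) emb (F i).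
Proof.
rewrite /emb exchange_big; apply: eq_bigr => A _ /=.
by rewrite clE_sum scaler_suml.
Qed.
Lemma embZ (c : R) x : emb (c *: x) = c *: emb x.
Proof. by rewrite scaler_sumr; apply: eq_bigr => A _; rewrite clE_scale scalerA. Qed.
Lemma emb_blade A : emb (blade A) = blade (phi @: A).
Proof.
rewrite /emb (bigD1 A) //= big1 => [|B /negPf BA]; first by rewrite addr0 /blade eqxx scale1r.
by rewrite {1}/blade BA scale0r.
Qed.

Lemma imset_symdiff A B : phi @: symdiff m A B = symdiff n (phi @: A) (phi @: B).
Proof.
apply/setP=> j; rewrite in_symdiff; apply/imsetP/idP => [[i]|].
  by move=> iAB ->; rewrite !mem_imset -?in_symdiff //; exact: phi_inj.
case jA: (j \in phi @: A); case jB: (j \in phi @: B) => //= _; [move/imsetP: jA jB|move/imsetP: jB jA].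
all: move=> [i iX ->]; rewrite mem_imset; try exact: phi_inj.
all: by move=> iY; exists i; rewrite // in_symdiff iX iY.
Qed.

(** A shift preserves the order of indices, and the sign depends on that order only. *)
Lemma clsgn_imset A B : clsgn n (phi @: A) (phi @: B) = clsgn m A B.
Proof.
rewrite !clsgnE big_imset /= => [|? ? _ _]; last exact: phi_inj.
apply: eq_bigr => i _; rewrite big_imset /= => [|? ? _ _]; last exact: phi_inj.
by apply: eq_bigr => j _; rewrite !phiE leq_add2l.
Qed.

Lemma embM x y : emb (x * y) = emb x * emb y.
Proof.
rewrite {1}(cl_blade_sum x) {1}(cl_blade_sum y) mulr_suml emb_sum [in RHS]/emb mulr_suml.
apply: eq_bigr => A _; rewrite !mulr_sumr emb_sum; apply: eq_bigr => B _.
rewrite -!scalerAl -!scalerAr !embZ bladeM embZ emb_blade bladeM.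
by rewrite imset_symdiff clsgn_imset.
Qed.

Lemma emb1 : emb 1 = 1.
Proof. by rewrite -!blade0 emb_blade imset0. Qed.

Lemma emb_inj : injective emb.
Proof.
have E x A : emb x (phi @: A) = x A.
  rewrite /emb clE_sum (bigD1 A) //= big1 => [|B BA].
    by rewrite addr0 clE_scale /blade eqxx mulr1.
  by rewrite clE_scale /blade (inj_eq (imset_inj phi_inj)) eq_sym (negPf BA) mulr0.
by move=> x y xy; apply: funext => A; rewrite -!E xy.
Qed.

Definition push u : 'rV[R]_n := \sum_i u 0 i *: basis (phi i).

Lemma push_phi u i : push u 0 (phi i) = u 0 i.
Proof.
rewrite /push summxE (bigD1 i) //= big1 => [|j ji]; rewrite !mxE ?eqxx ?mulr1 ?addr0 //.
by rewrite (inj_eq phi_inj) eq_sym (negPf ji) andbF mulr0.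
Qed.

Lemma emb_vec u : emb (vec u) = vec (push u).
Proof.
rewrite {1}/vec emb_sum /push.
have vec_sum I (r : seq I) (F : I -> 'rV_n) : vec (\sum_(i <- r) F i) = \sum_(i <- r) vec (F i).
  apply: (big_morph _ (@vecD n)); apply: (addrI (vec 0)).
  by rewrite -vecD !addr0.
rewrite vec_sum; apply: eq_bigr => i _; rewrite embZ vecZ emb_blade imset_set1; congr (_ *: _).
rewrite /vec (bigD1 (phi i)) //= big1 => [|j ji]; rewrite !mxE ?eqxx /= ?scale1r ?addr0 //.
by rewrite (negPf ji) scale0r.
Qed.

Lemma dot_push u : dot (push u) (push u) = dot u u.
Proof.
have E (v : 'rV_n) : dot (push u) v = \sum_i u 0 i * v 0 (phi i).
  rewrite /push (big_morph (fun w => dot w v) (id1 := 0) (op1 := +%R)) => [|? ?|]; first last.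
  - by rewrite -(scale0r 0) dotZl mul0r.
  - exact: dotDl.
  by apply: eq_bigr => i _; rewrite dotZl dotC dot_basis.
by rewrite E; apply: eq_bigr => i _; rewrite push_phi.
Qed.

Lemma phi_surj (j : 'I_n) : (a <= j < a + m)%N -> exists i, phi i = j.
Proof.
move=> jam; have im : (j - a < m)%N by lia.
by exists (Ordinal im); apply: val_inj; rewrite /= phiE /=; lia.
Qed.

Lemma supp_push u : supp a (a + m) (push u).
Proof.
move=> j jam; rewrite /push summxE big1 // => i _; rewrite !mxE eqxx /=.
case: eqP => [E|]; last by rewrite mulr0.
by move: jam; rewrite E phiE; have := ltn_ord i; lia.
Qed.

Lemma push_surj (v : 'rV[R]_n) : supp a (a + m) v -> exists u, push u = v.
Proof.
move=> Sv; exists (\row_i v 0 (phi i)); apply/rowP => j.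
case: (boolP (a <= j < a + m)%N) => [/phi_surj[i <-]|jam]; first by rewrite push_phi mxE.
by rewrite Sv // supp_push.
Qed.

Lemma emb_pin p x : pin 0 m p x -> pin a (a + m) p (emb x).
Proof.
elim=> [|{}p _ y [u [u1 _ ->]] _ IH]; first by rewrite emb1; exact: pin_one.
rewrite embM; apply: pin_cons => //; rewrite emb_vec; exists (push u).
by split=> //; [rewrite dot_push|exact: supp_push].
Qed.

Lemma emb_pin_surj p (y : Cl n) : pin a (a + m) p y -> exists2 x, pin 0 m p x & emb x = y.
Proof.
elim=> [|{}p _ {}y [v [v1 /push_surj[u uE] ->]] _ [x px <-]].
  by exists 1; [exact: pin_one|exact: emb1].
exists (vec u * x); last by rewrite embM emb_vec uE.
apply: pin_cons => //; exists u; split=> //; first by rewrite -dot_push uE.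
by move=> i; rewrite ltn_ord.
Qed.

(** The filter in [eps] selects the sets [A] whose image under [phi] is [B], which gives the
    coefficient of [emb x] at [B]. *)
Lemma epsE (L : seq nat) x : (forall i : 'I_m, (nth 0%N L i).-1 = phi i) -> eps m n L x = emb x.
Proof.
move=> LE; apply: funext => B; rewrite /eps /emb clE_sum big_mkcond; apply: eq_bigr => A _.
rewrite clE_scale /blade.
suff -> : [forall b : 'I_n, (b \in B) == [exists a0 in A, (nth 0%N L (val a0)).-1 == val b]]
          = (B == phi @: A) by case: eqP => _; rewrite ?mulr1 ?mulr0.
have E b : [exists a0 in A, (nth 0%N L (val a0)).-1 == val b] = (b \in phi @: A).
  apply/existsP/imsetP => [[i /andP[iA /eqP ib]]|[i iA ->]]; exists i => //.
    by apply: val_inj; rewrite /= -LE.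
  by rewrite iA LE eqxx.
apply/forallP/eqP => [Bb|-> b]; last by rewrite E.
by apply/setP => b; rewrite (eqP (Bb b)) E.
Qed.

End Embedding.

Section Eps.

Lemma shift_exists m n a : (a + m <= n)%N ->
  exists phi : 'I_m -> 'I_n, forall i, phi i = (a + i)%N :> nat.
Proof.
move=> amn; have lt (i : 'I_m) : (a + i < n)%N by have := ltn_ord i; lia.
by exists (fun i => Ordinal (lt i)).
Qed.

Lemma eps_emb m n a : (a + m <= n)%N -> exists2 phi : 'I_m -> 'I_n,
  forall i, phi i = (a + i)%N :> nat & forall x, eps m n (iota a.+1 m) x = emb phi x.
Proof.
move=> /shift_exists[phi phiE]; exists phi => // x; apply: epsE => i.
by rewrite nth_iota // addSn phiE.
Qed.

Variables (m n a : nat).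
Hypothesis amn : (a + m <= n)%N.
Local Notation E := (eps m n (iota a.+1 m)).

Lemma epsM x y : E (x * y) = E x * E y.
Proof. by have [phi phiE eE] := eps_emb amn; rewrite !eE (embM phiE). Qed.
Lemma eps1 : E 1 = 1.
Proof. by have [phi phiE eE] := eps_emb amn; rewrite !eE emb1. Qed.
Lemma eps_inj : injective E.
Proof. by have [phi phiE eE] := eps_emb amn; move=> x y; rewrite !eE; exact: (emb_inj phiE). Qed.
Lemma eps_spin x : spin 0 m x -> spin a (a + m) (E x).
Proof. by have [phi phiE eE] := eps_emb amn; rewrite eE; exact: (emb_pin phiE). Qed.
Lemma eps_spin_surj y : spin a (a + m) y -> exists2 x, spin 0 m x & E x = y.
Proof.
have [phi phiE eE] := eps_emb amn => /(emb_pin_surj phiE)[x sx xy].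
by exists x; rewrite ?eE.
Qed.
(** Shifts compose. The cases [b = 0] and [b = 1] restrict an edge embedding to its two vertex
    groups. *)
Lemma eps_comp k b x : (b + k <= m)%N ->
  E (eps k m (iota b.+1 k) x) = eps k n (iota (a + b).+1 k) x.
Proof.
move=> bkm; have [phi phiE eE] := eps_emb amn; have [psi psiE ->] := eps_emb bkm.
rewrite eE (@epsE _ _ (phi \o psi)) => [|i]; last first.
  by rewrite nth_iota //= phiE psiE addnA.
rewrite [emb psi x]/emb emb_sum [RHS]/emb; apply: eq_bigr => A _.
by rewrite embZ emb_blade; congr (_ *: blade _); exact/esym/imset_comp.
Qed.

End Eps.

(** * Comparison with Spin defined by lists of unit vectors *)

Section InSpin.
Variable n : nat.

Lemma unit_vectorE (x : Cl n) : unit_vector n x <-> uvec 0 n x.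
Proof.
split=> [[x0 x1]|[u [u1 _ ->]]].
  have xE : x = vec (\row_k x [set k]).
    apply: funext => C; have [/eqP/cards1P[k ->]|/eqP C1] := eqVneq #|C| 1%N.
      by rewrite vec_set1 mxE.
    by rewrite vec_ncard1 // x0.
  exists (\row_k x [set k]); split=> //; last by move=> i; rewrite ltn_ord.
  by rewrite -[RHS]x1; apply: eq_bigr => k _; rewrite mxE.
split=> [C C1|]; first by rewrite vec_ncard1.
by rewrite -[RHS]u1; apply: eq_bigr => k _; rewrite vec_set1.
Qed.

Lemma in_spinE (x : Cl n) : in_spin n x <-> spin 0 n x.
Proof.
have all_pin (l : seq (Cl n)) : List.Forall (unit_vector n) l -> pin 0 n (odd (size l)) (cl_prod n l).
  by elim=> [|y {}l /unit_vectorE uy _ IH]; [exact: pin_one|exact: pin_cons].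
split=> [[l [/negPf el [ul ->]]]|sx]; first by have := all_pin l ul; rewrite el.
suff [l [ol ul ->]] : exists l, [/\ odd (size l) = false, List.Forall (unit_vector n) l & x = cl_prod n l].
  by exists l; rewrite ol.
elim: sx => [|p u y /unit_vectorE uu _ [l [<- ul ->]]]; first by exists [::].
by exists (u :: l); split=> //; constructor.
Qed.

End InSpin.

(** * Groups with a membership predicate, and the edge groups *)

Section SubGroupType.
Variables (H : grp) (hH : is_group H).

(** The subtype of members turns a [grp] into a [groupType], as the gluing argument requires. The
    proof of [is_group H] is a parameter so that the group structure can be attached to the type. *)
Definition grp_type of is_group H : Type := {x : car H | gmem H x}.
Local Notation T := (grp_type hH).
Implicit Types x y z : T.

HB.instance Definition _ := gen_eqMixin T.
HB.instance Definition _ := gen_choiceMixin T.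

Definition grp_val x : car H := proj1_sig x.

Lemma grp_valP x : gmem H (grp_val x).
Proof. exact: proj2_sig x. Qed.

Lemma grp_val_inj : injective grp_val.
Proof. by move=> [x px] [y py] /= xy; exact: eq_exist. Qed.

Let one1 : T := exist _ (gone H) (let: conj h _ := hH in h).
Let mulP x y : gmem H (gmul H (grp_val x) (grp_val y)).
Proof. by have [_ [hM _]] := hH; apply: hM; exact: grp_valP. Qed.
Let mulT x y : T := exist _ _ (mulP x y).
Let invP x : {y : T | mulT x y = one1 /\ mulT y x = one1}.
Proof.
apply: cid; have [_ [_ [_ [_ hV]]]] := hH.
have [y [py [xy yx]]] := hV _ (grp_valP x).
by exists (exist _ y py); split; apply: grp_val_inj.
Qed.
Let invT x : T := sval (invP x).
Let mulTA : associative mulT.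
Proof.
move=> x y z; apply: grp_val_inj; have [_ [_ [hA _]]] := hH.
by apply: hA; exact: grp_valP.
Qed.
Let mul1T : left_id one1 mulT.
Proof.
by move=> x; apply: grp_val_inj; have [_ [_ [_ [h1 _]]]] := hH; have [] := h1 _ (grp_valP x).
Qed.
Let mulT1 : right_id one1 mulT.
Proof.
by move=> x; apply: grp_val_inj; have [_ [_ [_ [h1 _]]]] := hH; have [] := h1 _ (grp_valP x).
Qed.
Let mulVT : left_inverse one1 invT mulT.
Proof. by move=> x; rewrite /invT; case: (invP x) => y []. Qed.
Let mulTV : right_inverse one1 invT mulT.
Proof. by move=> x; rewrite /invT; case: (invP x) => y []. Qed.

HB.instance Definition _ := isGroup.Build T mulTA mul1T mulT1 mulVT mulTV.

Lemma grp_valM x y : grp_val (x * y)%g = gmul H (grp_val x) (grp_val y).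
Proof. by []. Qed.

Definition to_grp (h : car H) : T :=
  if pselect (gmem H h) is left p then exist _ h p else 1%g.

Lemma to_grpK h : gmem H h -> grp_val (to_grp h) = h.
Proof. by rewrite /to_grp; case: pselect. Qed.

Lemma to_grpM h h' : gmem H h -> gmem H h' -> to_grp (gmul H h h') = (to_grp h * to_grp h')%g.
Proof.
move=> hh hh'; apply: grp_val_inj; rewrite grp_valM !to_grpK //.
by have [_ [hM _]] := hH; exact: hM.
Qed.

End SubGroupType.

Section EdgeGroups.
Variables (n i j : nat).

(** The type [spin_edge i j] reduces only when [j == i.+1] is decided. [edge3] and [edge22] carry
    elements into it by the same dependent match, with dummy values in the other branch. *)
Definition edge3 : Cl 3 -> car (spin_edge i j) :=
  match j == i.+1 as b
    return Cl 3 -> car (if b then SpinG 3 else prodgrp (SpinG 2) (SpinG 2)) with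
  | true => fun x => x
  | false => fun=> (clone 2, clone 2)
  end.

Definition edge22 : Cl 2 * Cl 2 -> car (spin_edge i j) :=
  match j == i.+1 as b
    return Cl 2 * Cl 2 -> car (if b then SpinG 3 else prodgrp (SpinG 2) (SpinG 2)) with
  | true => fun=> clone 3
  | false => fun x => x
  end.

Section Adjacent.
Hypothesis ij : (j == i.+1) = true.

Lemma edge3_mem x : gmem (spin_edge i j) (edge3 x) <-> in_spin 3 x.
Proof. by move: ij; rewrite /spin_edge /edge3; case: (j == i.+1). Qed.
Lemma edge3M x y : edge3 (x * y) = gmul (spin_edge i j) (edge3 x) (edge3 y).
Proof. by move: ij; rewrite /spin_edge /edge3; case: (j == i.+1). Qed.
Lemma edge3_surj (z : car (spin_edge i j)) : exists x, z = edge3 x.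
Proof.
by move: ij z; rewrite /spin_edge /edge3; case: (j == i.+1) => // _ z; exists z.
Qed.
Lemma spin_phiL_edge3 x : spin_phiL i j x = edge3 (eps 2 3 (iota 1 2) x).
Proof. by move: ij; rewrite /spin_phiL /spin_edge /edge3; case: (j == i.+1). Qed.
Lemma spin_phiR_edge3 x : spin_phiR i j x = edge3 (eps 2 3 (iota 2 2) x).
Proof. by move: ij; rewrite /spin_phiR /spin_edge /edge3; case: (j == i.+1). Qed.
Lemma spin_tau_edge3 x : spin_tau n i j (edge3 x) = eps 3 n (iota i 3) x.
Proof. by move: ij; rewrite /spin_tau /= /spin_edge /edge3; case: (j == i.+1). Qed.

End Adjacent.

Section Distant.
Hypothesis ij : (j == i.+1) = false.

Lemma edge22_mem x : gmem (spin_edge i j) (edge22 x) <-> in_spin 2 x.1 /\ in_spin 2 x.2.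
Proof. by move: ij; rewrite /spin_edge /edge22; case: (j == i.+1). Qed.
Lemma edge22M x y : edge22 (x.1 * y.1, x.2 * y.2) = gmul (spin_edge i j) (edge22 x) (edge22 y).
Proof. by move: ij; rewrite /spin_edge /edge22; case: (j == i.+1). Qed.
Lemma edge22_surj (z : car (spin_edge i j)) : exists x, z = edge22 x.
Proof.
by move: ij z; rewrite /spin_edge /edge22; case: (j == i.+1) => // _ z; exists z.
Qed.
Lemma spin_phiL_edge22 x : spin_phiL i j x = edge22 (x, 1).
Proof. by move: ij; rewrite /spin_phiL /spin_edge /edge22; case: (j == i.+1). Qed.
Lemma spin_phiR_edge22 x : spin_phiR i j x = edge22 (1, x).
Proof. by move: ij; rewrite /spin_phiR /spin_edge /edge22; case: (j == i.+1). Qed.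
Lemma spin_tau_edge22 x :
  spin_tau n i j (edge22 x) = eps 2 n (iota i 2) x.1 * eps 2 n (iota j 2) x.2.
Proof. by move: ij; rewrite /spin_tau /= /spin_edge /edge22; case: (j == i.+1). Qed.

End Distant.
End EdgeGroups.

(** * Spin(n) as universal enveloping group *)

Lemma in_spinM m (x y : Cl m) : in_spin m x -> in_spin m y -> in_spin m (x * y).
Proof. by rewrite !in_spinE; exact: spinM. Qed.
Lemma in_spin1 m : in_spin m 1.
Proof. by apply/in_spinE; exact: spin1. Qed.

Lemma SpinG_is_group m : is_group (SpinG m).
Proof.
split; first exact: in_spin1.
split; first exact: in_spinM.
split=> [x y z _ _ _|]; first exact: mulrA.
split=> x; first by move=> _; split; [exact: mul1r|exact: mulr1].
by move/in_spinE/pinV => [y [sy xy yx]]; exists y; split; first exact/in_spinE.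
Qed.

Lemma eps_in_spin m n a x : (a + m <= n)%N -> in_spin m x ->
  spin a (a + m) (eps m n (iota a.+1 m) x).
Proof. by move=> amn /in_spinE; exact: eps_spin. Qed.

Section SpinTau.
Variable n : nat.

Lemma spin_phiL_mem i j x : in_spin 2 x -> gmem (spin_edge i j) (spin_phiL i j x).
Proof.
move=> sx; case E: (j == i.+1).
  rewrite spin_phiL_edge3 //; apply/edge3_mem => //; apply/in_spinE.
  by apply: pin_mono (eps_in_spin (a := 0) _ sx).
by rewrite spin_phiL_edge22 //; apply/edge22_mem => //; split=> //; exact: in_spin1.
Qed.

Lemma spin_phiR_mem i j x : in_spin 2 x -> gmem (spin_edge i j) (spin_phiR i j x).
Proof.
move=> sx; case E: (j == i.+1).
  rewrite spin_phiR_edge3 //; apply/edge3_mem => //; apply/in_spinE.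
  by apply: pin_mono (eps_in_spin (a := 1) _ sx).
by rewrite spin_phiR_edge22 //; apply/edge22_mem => //; split=> //; exact: in_spin1.
Qed.

Lemma spin_tau_phiL i j x : (0 < i < j)%N -> (j < n)%N ->
  spin_tau n i j (spin_phiL i j x) = eps 2 n (iota i 2) x.
Proof.
case: i => // i /andP[_ ij] jn; case E: (j == i.+2).
  rewrite spin_phiL_edge3 // spin_tau_edge3 //.
  by rewrite (@eps_comp 3 n i _ 2 0) ?addn0 //; move/eqP: E jn; lia.
rewrite spin_phiL_edge22 // spin_tau_edge22 //=.
by case: j ij jn E => // j ij jn _; rewrite (@eps1 2 n j) ?mulr1 //; lia.
Qed.

Lemma spin_tau_phiR i j x : (0 < i < j)%N -> (j < n)%N ->
  spin_tau n i j (spin_phiR i j x) = eps 2 n (iota j 2) x.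
Proof.
case: i => // i /andP[_ ij] jn; case E: (j == i.+2).
  rewrite spin_phiR_edge3 // spin_tau_edge3 // (eqP E).
  by rewrite (@eps_comp 3 n i _ 2 1) ?addn1 //; move/eqP: E jn; lia.
by rewrite spin_phiR_edge22 // spin_tau_edge22 //= (@eps1 2 n i) ?mul1r //; lia.
Qed.

Lemma spin_tau_vert i j x : inI n.-1 i -> inI n.-1 j -> i <> j ->
  vert_emb spin2_amalgam (SpinG n) (spin_tau n) i j x = eps 2 n (iota j 2) x.
Proof.
rewrite /inI /vert_emb => iI jI nij; case: ifP => ij.
  by apply: spin_tau_phiR; lia.
by apply: spin_tau_phiL; lia.
Qed.

Lemma spin_tau_hom i j : inI n.-1 i -> inI n.-1 j -> (i < j)%N ->
  Defs.hom (spin_edge i j) (SpinG n) (spin_tau n i j).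
Proof.
rewrite /inI; case: i => // i; case: j => // j iI jI ij; case E: (j.+1 == i.+2).
  have i3 : (i + 3 <= n)%N by move/eqP: E jI; lia.
  split=> [z|z z']; have [x ->] := edge3_surj E z.
    move/(edge3_mem E) => sx; rewrite spin_tau_edge3 //; apply/in_spinE.
    by apply: pin_mono (eps_in_spin i3 sx).
  by have [y ->] := edge3_surj E z'; rewrite -edge3M // !spin_tau_edge3 // (epsM i3).
have [i2 j2] : (i + 2 <= n)%N /\ (j + 2 <= n)%N by lia.
have eS k : (k + 2 <= n)%N -> forall x, in_spin 2 x -> in_spin n (eps 2 n (iota k.+1 2) x).
  by move=> k2 x sx; apply/in_spinE; apply: pin_mono (eps_in_spin k2 sx).
split=> [z|z z']; have [x ->] := edge22_surj E z.
  by move/(edge22_mem E) => [s1 s2]; rewrite spin_tau_edge22 //; apply: in_spinM; exact: eS.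
have [y ->] := edge22_surj E z' => /(edge22_mem E)[_ sx] /(edge22_mem E)[sy _].
rewrite -edge22M // !spin_tau_edge22 //= (epsM i2) (epsM j2) clmulM.
rewrite !mulrA; congr (_ * _); rewrite -!mulrA; congr (_ * _).
(* The product map on a non-adjacent edge is a homomorphism because even elements on disjoint
   coordinates commute. *)
by apply: (@spin_comm n i (i + 2) j (j + 2)); [move/eqP: E; lia|exact: eps_in_spin..].
Qed.

(** The plane at coordinate [j] belongs to vertex [j.+1]; it is reached through the right neighbour
    if there is one, and through the left neighbour otherwise. *)
Lemma spin_tau_image j y : (3 <= n)%N -> (j + 2 <= n)%N -> spin j j.+2 y ->
  exists i k z, [/\ inI n.-1 i, inI n.-1 k, (i < k)%N, gmem (spin_edge i k) z &
    y = spin_tau n i k z].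
Proof.
move=> n3 j2; rewrite -(addn2 j) => /(eps_spin_surj j2)[x /in_spinE sx <-].
have [j3|j3] := leqP (j + 3) n.
  exists j.+1, j.+2, (spin_phiL j.+1 j.+2 x); rewrite /inI; split; try lia.
    exact: spin_phiL_mem.
  by rewrite spin_tau_phiL //; lia.
exists j, j.+1, (spin_phiR j j.+1 x); rewrite /inI; split; try lia.
  exact: spin_phiR_mem.
by rewrite spin_tau_phiR //; lia.
Qed.

Lemma spin_enveloping : (3 <= n)%N -> enveloping n.-1 spin2_amalgam (SpinG n) (spin_tau n).
Proof.
move=> n3; split; first exact: SpinG_is_group.
split; first exact: spin_tau_hom.
split=> [h /in_spinE|i j k iI jI kI ij jk _ x _].
  move: h; apply: spin_gen_ind; first by lia.
    move=> j y _ jn sy; apply: gen_base; have [i [k [z [iI kI ik zm yE]]]] := spin_tau_image n3 jn sy.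
    by exists i, k, z.
  by move=> x y _ _; exact: gen_mul.
by rewrite !spin_tau_vert //; move=> kj; apply: jk.
Qed.

End SpinTau.

(** * The universal property *)

Section Universal.
Variables (n : nat) (n3 : (3 <= n)%N) (H : grp).
Variable tau : forall i j, car (agrp_e spin2_amalgam i j) -> car H.
Hypothesis envH : enveloping n.-1 spin2_amalgam H tau.

Let hH : is_group H. Proof. by case: envH. Qed.
Local Notation T := (grp_type hH).
Local Notation inH := (to_grp hH).

Let tau_hom i j : (0 < i < j)%N -> (j < n)%N -> Defs.hom (spin_edge i j) H (@tau i j).
Proof.
by move=> ij jn; have [_ [th _]] := envH; apply: th; rewrite /inI; lia.
Qed.

(* [vertex j] is the common value of [tau_ij o phi^j_ij] over all neighbours [i <> j]. *)
Definition vertex j : Cl 2 -> car H :=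
  vert_emb spin2_amalgam H tau (if j == 1 then 2 else j.-1)%N j.

Lemma tau_phiL i j x : (0 < i < j)%N -> (j < n)%N -> in_spin 2 x ->
  tau (spin_phiL i j x) = vertex i x.
Proof.
move=> ij jn sx; have [_ [_ [_ tv]]] := envH.
have -> : tau (spin_phiL i j x) = vert_emb spin2_amalgam H tau j i x.
  by rewrite /vert_emb ltnNge ltnW //; lia.
rewrite /vertex; have [->//|/eqP jk] := eqVneq j (if i == 1 then 2 else i.-1)%N.
by apply: tv => //; rewrite /inI; move: jk; case: eqP; lia.
Qed.

Lemma tau_phiR i j x : (0 < i < j)%N -> (j < n)%N -> in_spin 2 x ->
  tau (spin_phiR i j x) = vertex j x.
Proof.
move=> ij jn sx; have [_ [_ [_ tv]]] := envH.
have -> : tau (spin_phiR i j x) = vert_emb spin2_amalgam H tau i j x.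
  by rewrite /vert_emb ifT //; lia.
rewrite /vertex; have [->//|/eqP jk] := eqVneq i (if j == 1 then 2 else j.-1)%N.
by apply: tv => //; rewrite /inI; move: jk; case: eqP; lia.
Qed.

Lemma tau_mem i j z : (0 < i < j)%N -> (j < n)%N -> gmem (spin_edge i j) z -> gmem H (tau z).
Proof. by move=> ij jn; case: (tau_hom ij jn) => + _; exact. Qed.

Lemma tauM i j z z' : (0 < i < j)%N -> (j < n)%N -> gmem (spin_edge i j) z ->
  gmem (spin_edge i j) z' -> tau (gmul (spin_edge i j) z z') = gmul H (tau z) (tau z').
Proof. by move=> ij jn; case: (tau_hom ij jn) => _; exact. Qed.

(** Inverse of the embedding on its image, with default 0 elsewhere; it transports maps on the
    abstract edge and vertex groups to subgroups of [Cl n]. *)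
Definition eps_inv m a (y : Cl n) : Cl m :=
  if pselect (exists x, eps m n (iota a.+1 m) x = y) is left e then projT1 (cid e) else 0.

Lemma epsK m a x : (a + m <= n)%N -> eps_inv a (eps m n (iota a.+1 m) x) = x.
Proof.
move=> amn; rewrite /eps_inv; case: pselect => [e|[]]; last by exists x.
by case: cid => y /= /(eps_inj amn).
Qed.

Definition lift_edge a (y : Cl n) : T := inH (tau (edge3 a.+1 a.+2 (eps_inv a y))).
Definition lift_vertex a (y : Cl n) : T := inH (vertex a.+1 (eps_inv a y)).

Lemma lift_edgeE a x : (a + 3 <= n)%N ->
  lift_edge a (eps 3 n (iota a.+1 3) x) = inH (tau (edge3 a.+1 a.+2 x)).
Proof. by move=> a3; rewrite /lift_edge epsK. Qed.

Lemma lift_vertexE a x : (a + 2 <= n)%N ->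
  lift_vertex a (eps 2 n (iota a.+1 2) x) = inH (vertex a.+1 x).
Proof. by move=> a2; rewrite /lift_vertex epsK. Qed.

Lemma lift_edgeM a : (a + 3 <= n)%N -> multiplicative_on (spin a a.+3) (lift_edge a).
Proof.
move=> a3 y y'; rewrite -(addn3 a) => /(eps_spin_surj a3)[x /in_spinE sx <-].
move=> /(eps_spin_surj a3)[x' /in_spinE sx' <-].
have [i j] : (0 < a.+1 < a.+2)%N /\ (a.+2 < n)%N by lia.
have m z : in_spin 3 z -> gmem (spin_edge a.+1 a.+2) (edge3 a.+1 a.+2 z) by move/(edge3_mem (eqxx _)).
rewrite -(epsM a3) !lift_edgeE // (edge3M (eqxx _)) tauM //; try exact: m.
by apply: to_grpM; apply: tau_mem => //; exact: m.
Qed.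

Lemma lift_edgeL a y : (a + 3 <= n)%N -> spin a a.+2 y -> lift_edge a y = lift_vertex a y.
Proof.
move=> a3; have a2 : (a + 2 <= n)%N by lia.
rewrite -(addn2 a) => /(eps_spin_surj a2)[x /in_spinE sx <-].
rewrite lift_vertexE //; have := @eps_comp 3 n a a3 2 0 x isT; rewrite addn0 => <-; rewrite lift_edgeE //.
by rewrite -(spin_phiL_edge3 (eqxx _)) tau_phiL //; lia.
Qed.

Lemma lift_edgeR a y : (a + 3 <= n)%N -> spin a.+1 a.+3 y -> lift_edge a y = lift_vertex a.+1 y.
Proof.
move=> a3; have a2 : (a.+1 + 2 <= n)%N by lia.
rewrite -(addn2 a.+1) => /(eps_spin_surj a2)[x /in_spinE sx <-].
rewrite lift_vertexE //; have := @eps_comp 3 n a a3 2 1 x isT; rewrite addn1 => <-; rewrite lift_edgeE //.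
by rewrite -(spin_phiR_edge3 (eqxx _)) tau_phiR //; lia.
Qed.

(** In the direct product, (x, y) is both (x, 1)(1, y) and (1, y)(x, 1); this forces the vertex
    images to commute. *)
Lemma tau_edge22 i j x y : (0 < i)%N -> (i.+1 < j < n)%N -> in_spin 2 x -> in_spin 2 y ->
  inH (tau (edge22 i j (x, y))) = (inH (vertex i x) * inH (vertex j y))%g /\
  inH (tau (edge22 i j (x, y))) = (inH (vertex j y) * inH (vertex i x))%g.
Proof.
move=> i0 /andP[ij jn] sx sy; have E : (j == i.+1) = false by apply/eqP; lia.
have i0j : (0 < i < j)%N by lia.
rewrite -(@tau_phiL i j) // -(@tau_phiR i j) //.
have [Lm Rm] := (@spin_phiL_mem i j x sx, @spin_phiR_mem i j y sy).
rewrite -!to_grpM -?tauM //; try exact: tau_mem.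
rewrite spin_phiL_edge22 // spin_phiR_edge22 // -!edge22M //=.
by rewrite !mul1r !mulr1.
Qed.

Lemma lift_vertex_comm i j x y : (i.+1 < j)%N -> (j + 2 <= n)%N ->
  spin i i.+2 x -> spin j j.+2 y -> commute (lift_vertex i x) (lift_vertex j y).
Proof.
move=> ij j2; have i2 : (i + 2 <= n)%N by lia.
rewrite -(addn2 i) -(addn2 j) => /(eps_spin_surj i2)[u /in_spinE su <-].
move=> /(eps_spin_surj j2)[v /in_spinE sv <-]; rewrite !lift_vertexE //.
have [||e1 e2] := @tau_edge22 i.+1 j.+1 u v _ _ su sv; [by []|lia|].
by rewrite /commute -e1 -e2.
Qed.

Lemma universal_map : exists pi : Cl n -> car H,
  [/\ Defs.hom (SpinG n) H pi,
      forall h', gmem H h' -> exists h, gmem (SpinG n) h /\ pi h = h',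
      compatible n.-1 spin2_amalgam (SpinG n) H (spin_tau n) tau pi &
      forall pi', Defs.hom (SpinG n) H pi' ->
        compatible n.-1 spin2_amalgam (SpinG n) H (spin_tau n) tau pi' ->
        forall h, gmem (SpinG n) h -> pi' h = pi h].
Proof.
have [p [pM ps pt]] := path_amalgam_hom lift_edgeM lift_edgeL lift_edgeR lift_vertex_comm n3.
pose pi h := grp_val (p h).
have piM x y : in_spin n x -> in_spin n y -> pi (x * y) = gmul H (pi x) (pi y).
  by rewrite !in_spinE => sx sy; rewrite /pi pM // grp_valM.
have pi_tau : compatible n.-1 spin2_amalgam (SpinG n) H (spin_tau n) tau pi.
  move=> i j z; rewrite /inI; case: i z => // i; case: j => // j z iI jI ij zm.
  have [i0 jn] : (0 < i.+1 < j.+1)%N /\ (j.+1 < n)%N by lia.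
  have tz := tau_mem i0 jn zm; rewrite -[RHS](to_grpK hH tz) /pi; congr grp_val.
  case E: (j.+1 == i.+2).
    have i3 : (i + 3 <= n)%N by move/eqP: E jI; lia.
    (* The type of [z] depends on [j], so [z] is generalised before [j] is replaced by [i.+1]. *)
    case: (eqP E) (E) z zm {tz} => -> {}E z; have [x ->] := edge3_surj E z.
    move/(edge3_mem E) => sx; rewrite spin_tau_edge3 // (pt i) ?lift_edgeE //.
    by rewrite -(addn3 i); exact: eps_in_spin.
  have [i2 j2] : (i + 2 <= n)%N /\ (j + 2 <= n)%N by lia.
  have [[x y] zE] := edge22_surj E z; move: zm; rewrite zE => /(edge22_mem E)[/= sx sy].
  rewrite spin_tau_edge22 //=.
  have [sx' sy'] := (eps_in_spin i2 sx, eps_in_spin j2 sy).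
  rewrite pM; last 2 first.
  - by apply: pin_mono sx'.
  - by apply: pin_mono sy'.
  rewrite (addn2 i) in sx'; rewrite (addn2 j) in sy'.
  rewrite (ps i) // (ps j) // !lift_vertexE //.
  have [||<- //] := @tau_edge22 i.+1 j.+1 x y _ _ sx sy; [by []|move/eqP: E; lia].
exists pi; split=> //.
- by split=> [x _|]; [exact: grp_valP|exact: piM].
(* Surjectivity: induction over the generation of [H], each generator being lifted through
   [spin_tau]. *)
- have [_ [_ [gH _]]] := envH; move=> h' /gH; elim=> {h'}.
  + move=> _ [i [j [z [iI jI ij zm ->]]]]; exists (spin_tau n i j z); split; last exact: pi_tau.
    by have [m _] := spin_tau_hom iI jI ij; exact: m.
  + exists 1; split; first exact: in_spin1.
    have p1 : p 1 = 1%g by apply: (mulgI (p 1)); rewrite -pM ?mulr1 ?mulg1 //; exact: spin1.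
    by rewrite /pi p1.
  + move=> _ _ _ [x [sx <-]] _ [y [sy <-]]; exists (x * y); split; first exact: in_spinM.
    exact: piM.
  (* Here [y] is a right inverse of [pi x], so by cancellation it is the image of the inverse of
     [x]. *)
  + move=> _ y _ [x [/in_spinE sx <-]] ym xy; have [x' [sx' xx' _]] := pinV sx.
    exists x'; split; first exact/in_spinE.
    have p1 : p 1 = 1%g by apply: (mulgI (p 1)); rewrite -pM ?mulr1 ?mulg1 //; exact: spin1.
    rewrite -(to_grpK hH ym) /pi; congr grp_val; apply: (mulgI (p x)).
    rewrite -pM // xx' p1; apply: grp_val_inj.
    by rewrite grp_valM (to_grpK hH ym) xy.
(* Uniqueness: compatibility fixes the values on every coordinate plane, and these planes
   generate. *)
- move=> pi' [_ pi'M] pi'_tau h /in_spinE; move: h; apply: spin_gen_ind; first by lia.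
    move=> j y _ jn sy; have [i [k [z [iI kI ik zm ->]]]] := spin_tau_image n3 jn sy.
    by rewrite pi'_tau // pi_tau.
  move=> x y /in_spinE sx /in_spinE sy px py.
  by have := pi'M _ _ sx sy; rewrite px py -piM.
Qed.

End Universal.

Theorem mainTheorem6 (n : nat) (hn : (3 <= n)%N) :
  universal_enveloping n.-1 spin2_amalgam (SpinG n) (spin_tau n).
Proof.
split; first exact: spin_enveloping.
by move=> H' tau' envH'; exact: universal_map.
Qed.
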